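(* Let $q$ be a prime power with $q\equiv 1\pmod 3$ and $m:=(q-1)/3$. Let $P$ be a place of $\overline{Y}_3$ that is not $\mathbb{F}_{q^2}$-rational and suppose that the $\mathcal{Q}$-order of $P$ is at most $m-1$. Then $G(P)\neq G_{\mathrm{gen}}$, where $$G_{\mathrm{gen}}:=\{jq+k\mid j=0,\dots,m-1,\ k=1,\dots,q-2-3j\}.$$
   Context: $Y_3:=\mathbb{F}_{q^2}(x,y)$ is the function field over $\mathbb{F}_{q^2}$ defined by $x^q+xy^{(q-1)/3}-y^{(2q+1)/3}=0$ (it is $\mathbb{F}_{q^2}$-maximal of genus $(q^2-q)/6$), and $\overline{Y}_3:=\overline{\mathbb{F}}_{q^2}Y_3$ is its constant field extension to the algebraic closure. There are distinguished $\mathbb{F}_{q^2}$-rational places $P_\infty,P_{(0,0)},P_0^1,\dots,P_0^m$, determined by the divisors $(x)=\frac{q+2}{3}P_{(0,0)}+D_0-\frac{2q+1}{3}P_\infty$ and $(y)=P_{(0,0)}+3D_0-qP_\infty$, where $D_0:=\sum_{i=1}^mP_0^i$. Every other place $P$ of $\overline{Y}_3$ is uniquely determined by $a:=x(P)$ and $b:=y(P)$, which are nonzero elements of $\overline{\mathbb{F}}_{q^2}$; for such a place $\alpha(P):=b^{(q+2)/3}/a$. A place of $\overline{Y}_3$ is called $\mathbb{F}_{q^2}$-rational if it comes from a degree-one place of $Y_3$. Let $\zeta_3\in\overline{\mathbb{F}}_{q^2}$ be a primitive cube root of unity; every non-$\mathbb{F}_{q^2}$-rational place satisfies $\alpha(P)\notin\{0,1,-\zeta_3,-\zeta_3^2\}$.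 For $i\in\mathbb{Z}_{>0}$ let $$\mathcal{Q}_i(s):=\frac{\frac{1-\zeta_3}{3}(s+\zeta_3)^{3i-1}+\frac{1-\zeta_3^2}{3}(s+\zeta_3^2)^{3i-1}}{s-1},$$ which is a polynomial. The $\mathcal{Q}$-order of $P$ is the smallest positive integer $K$ with $\mathcal{Q}_{K+1}(1-\alpha(P))=0$ if such $K$ exists, and $\infty$ otherwise. For a place $P$ of $\overline{Y}_3$, $H(P)$ is the set of non-negative integers $n$ such that some function in $\overline{Y}_3$ has pole divisor exactly $nP$, and $G(P):=\mathbb{Z}_{\ge0}\setminus H(P)$ is the set of gaps. *)

(* Defs.v *)
From HB Require Import structures.
From mathcomp Require Import all_boot all_order all_algebra.
From mathcomp Require Import boolp classical_sets.
From mathcomp Require Import ring.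

Set Implicit Arguments.
Unset Strict Implicit.
Unset Printing Implicit Defensive.

Import GRing.Theory.
Local Open Scope classical_set_scope.
Local Open Scope ring_scope.

(* The smallest subfield of L containing S is L itself. *)
Definition field_generated (L : fieldType) (S : set L) : Prop :=
  forall A : {pred L}, divring_closed A ->
    (forall z, S z -> z \in A) -> forall z, z \in A.

(* K being algebraically closed, this says that K is an algebraic closure of
   the image of F. *)
Definition is_algebraic_closure (F : fieldType) (K : closedFieldType)
    (iFK : {rmorphism F -> K}) : Prop :=
  forall c : K, algebraicOver iFK c.

(* The function field Y = F(x, y) of the curve
   x^q + x y^((q-1)/3) - y^((2q+1)/3) = 0.  The polynomial is absolutely
   irreducible, and transcendence of x excludes the specialisations of (x, y)
   to algebraic points, so (Y, x, y) is determined up to F-isomorphism. *)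
Definition is_function_field_Y3 (q : nat) (F Y : fieldType)
    (iFY : {rmorphism F -> Y}) (x y : Y) : Prop :=
  [/\ x ^+ q + x * y ^+ ((q - 1) %/ 3) - y ^+ ((2 * q + 1) %/ 3) = 0,
      ~ algebraicOver iFY x
    & field_generated [set z | (exists c : F, z = iFY c) \/ z = x \/ z = y]].

(* L is the compositum K Y, the constant fields being compatible. *)
Definition is_constant_field_extension (F K Y L : fieldType)
    (iFK : {rmorphism F -> K}) (iFY : {rmorphism F -> Y})
    (iKL : {rmorphism K -> L}) (iYL : {rmorphism Y -> L}) : Prop :=
  (forall c : F, iKL (iFK c) = iYL (iFY c)) /\
  field_generated
    [set z | (exists c : K, z = iKL c) \/ (exists w : Y, z = iYL w)].

Definition is_valuation_ring (k L : fieldType) (i : {rmorphism k -> L})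
    (O : {pred L}) : Prop :=
  [/\ subring_closed O,
      forall c : k, i c \in O,
      exists z : L, z \notin O
    & forall z : L, (z \in O) || (z^-1 \in O)].

(* A place is represented by its valuation ring, which determines it. *)
Record place (k L : fieldType) (i : {rmorphism k -> L}) := Place {
  vring : {pred L};
  vringP : is_valuation_ring i vring
}.

Section Places.
Variables (k L : fieldType) (i : {rmorphism k -> L}).
Implicit Types (P Q : place i) (f z t u : L) (n : nat).

Definition vunit P : {pred L} :=
  [pred z | [&& z != 0, z \in vring P & z^-1 \in vring P]].

Definition maxideal P : {pred L} :=
  [pred z | (z \in vring P) && (z \notin vunit P)].

(* The maximal ideal is t O_P. *)
Definition uniformizer P t : Prop :=
  t \in maxideal P /\
  forall z, z \in maxideal P -> exists2 w, w \in vring P & z = t * w.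

(* v_P(f) for f <> 0: the exponent n in f = u t^n, with u a unit and t a
   uniformizer at P.  The value at f = 0 is meaningless. *)
Definition valuation P f : int :=
  xget 0 [set n : int | exists t u,
            [/\ uniformizer P t, u \in vunit P & f = u * t ^ n]].

Definition pole_divisor f P : int :=
  if valuation P f < 0 then - valuation P f else 0.

Definition point_divisor n P : place i -> int :=
  fun Q => if `[< Q = P >] then n%:Z else 0.

Definition nongaps P : set nat :=
  [set n | exists f, f != 0 /\ forall Q, pole_divisor f Q = point_divisor n P Q].

Definition gaps P : set nat := ~` nongaps P.

(* f(P): the constant to which f reduces modulo the maximal ideal.  It is 0
   when there is none, in particular when f has a pole at P. *)
Definition residue P f : k := xget 0 [set c : k | f - i c \in maxideal P].

(* deg P = 1: the embedding of k in the residue field O_P / P is onto. *)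
Definition degree_one P : Prop :=
  forall z, z \in vring P -> exists c : k, z - i c \in maxideal P.

End Places.

(* P lies over P': O_P' is the contraction of O_P. *)
Definition lies_over (F K Y L : fieldType)
    (iFY : {rmorphism F -> Y}) (iKL : {rmorphism K -> L})
    (iYL : {rmorphism Y -> L}) (P : place iKL) (P' : place iFY) : Prop :=
  forall w : Y, (w \in vring P') = (iYL w \in vring P).

Definition rational_place (F K Y L : fieldType)
    (iFY : {rmorphism F -> Y}) (iKL : {rmorphism K -> L})
    (iYL : {rmorphism Y -> L}) (P : place iKL) : Prop :=
  exists P' : place iFY, degree_one P' /\ lies_over iYL P P'.

(* Meaningful at the places outside the supports of (x) and (y); the
   finitely many others are all rational. *)
Definition alpha (q : nat) (K L : fieldType) (iKL : {rmorphism K -> L})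
    (x y : L) (P : place iKL) : K :=
  residue P y ^+ ((q + 2) %/ 3) / residue P x.

Section Qpolynomials.
Variables (K : fieldType) (zeta3 : K).

Definition Qnum (i : nat) : {poly K} :=
  ((1 - zeta3) / 3%:R) *: ('X + zeta3%:P) ^+ (3 * i - 1)
  + ((1 - zeta3 ^+ 2) / 3%:R) *: ('X + (zeta3 ^+ 2)%:P) ^+ (3 * i - 1).

(* Only used for i > 0, where the division is exact (Qnum_dvd). *)
Definition Qpoly (i : nat) : {poly K} := Qnum i %/ ('X - 1%:P).

Lemma Qnum_dvd (i : nat) :
  3.-primitive_root zeta3 -> (0 < i)%N -> 'X - 1%:P %| Qnum i.
Proof.
move=> z3 i0; have z31 : zeta3 ^+ 3 = 1 by exact: prim_expr_order.
have zn1 : zeta3 - 1 != 0.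
  rewrite subr_eq0; apply/eqP => z1.
  by have := prim_order_dvd z3 1; rewrite z1 expr1n eqxx.
have s0 : 1 + zeta3 + zeta3 ^+ 2 = 0.
  apply: (mulfI zn1); rewrite mulr0.
  by transitivity (zeta3 ^+ 3 - 1); [ring | rewrite z31 subrr].
case: i i0 => // i _.
rewrite dvdp_XsubCl /root /Qnum !(hornerE, horner_exp).
have -> : 1 + zeta3 ^+ 2 = - zeta3.
  by apply/eqP; rewrite -addr_eq0 addrAC s0.
have -> : 1 + zeta3 = - zeta3 ^+ 2 by apply/eqP; rewrite -addr_eq0 s0.
have -> : (3 * i.+1 - 1 = 3 * i + 2)%N by rewrite mulnS addnC -addnBA.
have e3 (u : K) : u ^+ 3 = 1 -> (- u) ^+ (3 * i + 2) = (-1) ^+ i * u ^+ 2.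
  by move=> u3; rewrite exprD exprM sqrrN (exprNn u 3) u3 mulr1 -signr_odd expr1.
rewrite !e3 ?z31 //; last by rewrite -exprM mulnC exprM z31 expr1n.
apply/eqP; move: _^-1 ((-1) ^+ i : K) => c s; transitivity
  (s * c * zeta3 ^+ 2 * (1 - zeta3) * (1 + zeta3 + zeta3 ^+ 2)).
  by ring.
by rewrite s0 mulr0.
Qed.

(* The least positive n with Q_(n+1)(s) = 0, or None (for infinity). *)
Definition Qorder_at (s : K) : option nat :=
  match pselect (exists n, (0 < n)%N && root (Qpoly n.+1) s) with
  | left e => Some (ex_minn e)
  | right _ => None
  end.

End Qpolynomials.

Definition Qorder (K L : fieldType) (iKL : {rmorphism K -> L})
    (zeta3 : K) (q : nat) (x y : L) (P : place iKL) : option nat :=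
  Qorder_at zeta3 (1 - alpha q x y P).

(* Comparison in nat + {infinity}, None being infinity. *)
Definition order_le (o : option nat) (n : nat) : Prop :=
  exists2 k : nat, o = Some k & (k <= n)%N.

Definition Ggen (q : nat) : set nat :=
  [set n | exists j k : nat,
     [/\ (j < (q - 1) %/ 3)%N, (1 <= k <= q - 2 - 3 * j)%N
       & n = (j * q + k)%N]].

(* Main.v *)
(* Put q = 3m + 1 and z = x^3/y.  The curve is the quotient of the Hermitian
   curve s^q + s = t^(q+1) by (s, t) |-> (w^2 s, w t), w = zeta3, through
   x = s t, y = t^3, z = s^3; in particular x (z^m + 1) = y^(m+1).  Let (s0, t0)
   lie over P and let Phi(P) be the image of P under the q^2-Frobenius.  The
   product pi of the three conjugate tangent lines X_0, X_1, X_2 of the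
   Hermitian curve at the points over P is a linear form in 1, x, y, z with
   divisor q P + Phi(P) - (q+1) P_infinity.

   Let k be the Q-order of P and j = m - k.  There is a cyclically invariant form
   f0 of degree 3j in X_0, X_1, X_2 whose restriction to X_0 = 0 is
   (t - t0)^(3j-1) (t - t0^(q^2)): such a form exists iff the restriction takes
   compatible values at the two vertices of the triangle on X_0 = 0, and this
   condition turns out to be Q_(k+1)(1 - alpha(P)) = 0.  As X_0 vanishes to order
   q at P, f0 has order exactly 3j - 1 < q there, and it vanishes at Phi(P), where
   pi is a uniformizer.  So f0 / pi^j - c(1/pi), for the polynomial c of degree
   < j removing the principal part at Phi(P), has pole divisor
   (j q - 3j + 1) P.  This nongap (j - 1) q + (q - 3j + 1) lies in G_gen. *)

Require Import Defs.
From HB Require Import structures.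
From mathcomp Require Import all_boot all_order all_algebra all_field.
From mathcomp Require Import boolp classical_sets.
From mathcomp Require Import ring zify.

Set Implicit Arguments.
Unset Strict Implicit.
Unset Printing Implicit Defensive.

Import Order.TTheory GRing.Theory Num.Theory.
Local Open Scope ring_scope.

(** * Places as valuation rings *)

(** The Hermitian function field is never constructed: everything happens in [L], where only the
    invariants x, y, z of the cover are at hand. Two devices replace the cover. Globally, a tangent
    line is a polynomial in an indeterminate T standing for t, with s = (x/y) T^2; f0 is a trace
    back to [L], and its poles are bounded by estimates on cubes. Locally, where y does not vanish,
    a cube root of y modulo a high power of the local parameter gives approximate coordinates (s,
    t), and orders are read off from congruences. Places are bare valuation rings, so uniformizers,
    degree one and the uniqueness of the place with a given centre all come from one computation at
    smooth points of plane models, over [K] and over the finite field alike. Non-rationality of P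
    makes s0 and t0 nonzero, separates P from Phi(P), and keeps X_1 and X_2 away from zero at both.
    The Q-polynomial arises as follows: the two vertex values are proportional to nu^e mu^q and mu^e
    nu^q, with mu = s0^q - w s0, nu = s0^q - w^2 s0 and e = 3j - 1. Cancelling e-th powers leaves
    exponent q - e = 3(k+1) - 1, and 1 - alpha(P) = -s0^(q-1). *)

Section PlaceTheory.
Variables (k M : fieldType) (i : {rmorphism k -> M}).
Implicit Types (P Q : place i) (z t d : M) (c : k).

Fact vring_subring P : subring_closed (vring P).
Proof. by case: (vringP P). Qed.

HB.instance Definition _ P :=
  GRing.isSubringClosed.Build M (vring P) (vring_subring P).

Lemma vringC P c : i c \in vring P.
Proof. by case: (vringP P). Qed.

Lemma vring_total P z : (z \in vring P) || (z^-1 \in vring P).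
Proof. by case: (vringP P). Qed.

Lemma vunitE P z :
  (z \in vunit P) = [&& z != 0, z \in vring P & z^-1 \in vring P].
Proof. by []. Qed.

Lemma maxidealE P z : (z \in maxideal P) = (z \in vring P) && (z \notin vunit P).
Proof. by []. Qed.

Lemma vunitW P z : z \in vunit P -> z \in vring P.
Proof. by case/and3P. Qed.

Lemma vunit_neq0 P z : z \in vunit P -> z != 0.
Proof. by case/and3P. Qed.

Lemma maxidealW P z : z \in maxideal P -> z \in vring P.
Proof. by case/andP. Qed.

Lemma vunitN_maxideal P z : z \in vring P -> (z \in maxideal P) = (z \notin vunit P).
Proof. by move=> zO; rewrite maxidealE zO. Qed.

Lemma vunitC P c : c != 0 -> i c \in vunit P.
Proof. by move=> c0; rewrite vunitE fmorph_eq0 c0 -fmorphV !vringC. Qed.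

Fact vunit_div P : divr_closed (vunit P).
Proof.
split=> [|x y /and3P[x0 xO xVO] /and3P[y0 yO yVO]].
  by rewrite vunitE oner_eq0 invr1 rpred1.
by rewrite vunitE mulf_eq0 invr_eq0 negb_or x0 y0 invfM invrK !rpredM.
Qed.

HB.instance Definition _ P := GRing.isDivClosed.Build M (vunit P) (vunit_div P).

Lemma maxideal0 P : 0 \in maxideal P.
Proof. by rewrite maxidealE rpred0 vunitE eqxx. Qed.

Lemma maxidealV P z : z \notin vring P -> z^-1 \in maxideal P.
Proof.
move=> zO; have := vring_total P z; rewrite (negPf zO) /= => zV.
by rewrite maxidealE zV vunitE invrK (negPf zO) !andbF.
Qed.

Lemma maxidealV_notin P z : z \in maxideal P -> z != 0 -> z^-1 \notin vring P.
Proof. by case/andP => zO; rewrite vunitE zO => + z0; rewrite z0. Qed.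

Lemma maxidealMl P z t : z \in vring P -> t \in maxideal P -> z * t \in maxideal P.
Proof.
move=> zO tm; have tO := maxidealW tm.
rewrite vunitN_maxideal; last exact: rpredM.
apply/negP; rewrite vunitE => /and3P[].
rewrite mulf_eq0 negb_or => /andP[z0 t0] _ ztV.
have /negP[] := maxidealV_notin tm t0.
have -> : t^-1 = z * (z * t)^-1 by field; rewrite z0 t0.
exact: rpredM.
Qed.

Lemma maxidealMr P z t : z \in maxideal P -> t \in vring P -> z * t \in maxideal P.
Proof. by move=> zm tO; rewrite mulrC maxidealMl. Qed.

Fact maxideal_zmod P : zmod_closed (maxideal P).
Proof.
split=> [|x y xm ym]; first exact: maxideal0.
have xO := maxidealW xm; have yO := maxidealW ym.
have [->|x0] := eqVneq x 0; first by rewrite sub0r -mulN1r maxidealMl ?rpredN1.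
have [->|y0] := eqVneq y 0; first by rewrite subr0.
have [xy|yx] := orP (vring_total P (x / y)).
  have -> : x - y = (x / y - 1) * y by field.
  by rewrite maxidealMl ?rpredB ?rpred1.
have -> : x - y = (1 - (x / y)^-1) * x by field; rewrite x0 y0.
by rewrite maxidealMl ?rpredB ?rpred1.
Qed.

HB.instance Definition _ P :=
  GRing.isZmodClosed.Build M (maxideal P) (maxideal_zmod P).

Lemma maxidealX P z n : (0 < n)%N -> z \in maxideal P -> z ^+ n \in maxideal P.
Proof.
by case: n => // n _ zm; rewrite exprS maxidealMr // rpredX // maxidealW.
Qed.

Lemma vunit_maxidealF P z : z \in vunit P -> z \in maxideal P -> False.
Proof. by move=> zu; rewrite maxidealE zu andbF. Qed.

Lemma vring_dec P z : z \in vring P -> (z \in vunit P) + (z \in maxideal P).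
Proof. by move=> zO; rewrite vunitN_maxideal //; case: (boolP (_ \in vunit _)); auto. Qed.

Lemma vunitDm P z t : z \in vunit P -> t \in maxideal P -> z + t \in vunit P.
Proof.
move=> zu tm; have zO := vunitW zu; have tO := maxidealW tm.
have [//|ztm] := vring_dec (rpredD zO tO).
case: (@vunit_maxidealF P z) => //.
have -> : z = z + t - t by ring.
by rewrite rpredB.
Qed.

Lemma maxideal_eqm P z t : z - t \in maxideal P -> (z \in maxideal P) = (t \in maxideal P).
Proof.
move=> ztm; apply/idP/idP => zm.
  have -> : t = z - (z - t) by ring.
by rewrite rpredB.
have -> : z = (z - t) + t by ring.
by rewrite rpredD.
Qed.

Lemma vring_expI P z n : (0 < n)%N -> z ^+ n \in vring P -> z \in vring P.
Proof.
move=> n0 znO; apply/negPn/negP => zO; have zVm := maxidealV zO.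
have z0 : z != 0 by apply: contraNneq zO => ->; rewrite rpred0.
have := maxidealV_notin (maxidealX n0 zVm).
by rewrite expf_eq0 n0 invr_eq0 (negPf z0) -exprVn invrK znO => /(_ isT).
Qed.

Lemma maxideal_expI P z n : (0 < n)%N -> z ^+ n \in maxideal P -> z \in maxideal P.
Proof.
move=> n0 znm; have zO := vring_expI n0 (maxidealW znm).
case: (vring_dec zO) => // zu; case: (@vunit_maxidealF P (z ^+ n)) => //.
exact: rpredX.
Qed.

Lemma constm P c : (i c \in maxideal P) = (c == 0).
Proof.
have [->|c0] := eqVneq c 0; first by rewrite rmorph0 maxideal0.
by apply/negP => /(vunit_maxidealF (vunitC P c0)).
Qed.

Lemma residue_uniq P z c c' : z - i c \in maxideal P -> z - i c' \in maxideal P -> c = c'.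
Proof.
move=> zc zc'; apply/eqP; rewrite -subr_eq0 -(constm P) rmorphB.
have -> : i c - i c' = (z - i c') - (z - i c) by ring.
by rewrite rpredB.
Qed.

Lemma residueE P z c : z - i c \in maxideal P -> residue P z = c.
Proof. by move=> zc; apply: xget_unique => // c' /(residue_uniq zc) ->. Qed.

Lemma residueD P z t c c' : z - i c \in maxideal P -> t - i c' \in maxideal P ->
  z + t - i (c + c') \in maxideal P.
Proof.
move=> zc tc; rewrite rmorphD.
have -> : z + t - (i c + i c') = (z - i c) + (t - i c') by ring.
by rewrite rpredD.
Qed.

Lemma residueN P z c : z - i c \in maxideal P -> - z - i (- c) \in maxideal P.
Proof. by move=> zc; rewrite rmorphN -opprD rpredN. Qed.

Lemma residueB P z t c c' : z - i c \in maxideal P -> t - i c' \in maxideal P ->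
  z - t - i (c - c') \in maxideal P.
Proof. by move=> zc tc; apply: residueD => //; apply: residueN. Qed.

Lemma residue_vring P z c : z - i c \in maxideal P -> z \in vring P.
Proof.
move=> zc; have -> : z = (z - i c) + i c by ring.
by rewrite rpredD ?vringC // maxidealW.
Qed.

Lemma residueM P z t c c' : z - i c \in maxideal P -> t - i c' \in maxideal P ->
  z * t - i (c * c') \in maxideal P.
Proof.
move=> zc tc; rewrite rmorphM; have tO := residue_vring tc.
have -> : z * t - i c * i c' = (z - i c) * t + i c * (t - i c') by ring.
by apply: rpredD; [apply: maxidealMr | apply: maxidealMl => //; apply: vringC].
Qed.

Lemma residueC P c : i c - i c \in maxideal P.
Proof. by rewrite subrr maxideal0. Qed.

Lemma residueX P z c n : z - i c \in maxideal P -> z ^+ n - i (c ^+ n) \in maxideal P.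
Proof.
move=> zc; elim: n => [|n IH]; first by rewrite rmorph1 subrr maxideal0.
by rewrite !exprS; apply: residueM.
Qed.

Lemma residue_unit P z c : z - i c \in maxideal P -> (z \in vunit P) = (c != 0).
Proof.
move=> zc; have zO := residue_vring zc.
by rewrite -(constm P) -(maxideal_eqm zc) vunitN_maxideal ?negbK.
Qed.

Lemma residue_max P z c : z - i c \in maxideal P -> (z \in maxideal P) = (c == 0).
Proof. by move=> zc; rewrite (maxideal_eqm zc) constm. Qed.

Lemma residueV P z c : c != 0 -> z - i c \in maxideal P -> z^-1 - i c^-1 \in maxideal P.
Proof.
move=> c0 zc; have zu : z \in vunit P by rewrite (residue_unit zc).
rewrite fmorphV; have z0 := vunit_neq0 zu.
have -> : z^-1 - (i c)^-1 = (- z^-1 * (i c)^-1) * (z - i c).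
  by field; rewrite z0 fmorph_eq0 c0.
apply: maxidealMl => //; rewrite -fmorphV; apply: rpredM; last exact: vringC.
by rewrite rpredN vunitW // rpredV.
Qed.

Lemma uniformizer_neq0 P t : uniformizer P t -> t != 0.
Proof.
case: (vringP P) => _ _ [z zO] _ [_ tP]; have [w _ zt] := tP _ (maxidealV zO).
apply: contraNneq zO => t0; move: zt; rewrite t0 mul0r => /eqP.
by rewrite invr_eq0 => /eqP ->; rewrite rpred0.
Qed.

Lemma expz_unit_eq0 P t (n : int) : t \in maxideal P -> t != 0 -> t ^ n \in vunit P -> n = 0.
Proof.
move=> tm t0; case: n => [[|n]|n] //.
  by rewrite -exprnP => /vunit_maxidealF[]; apply: maxidealX.
rewrite NegzE -exprnN rpredV => /vunit_maxidealF[]; exact: maxidealX.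
Qed.

(** [valuation] picks an arbitrary admissible exponent, so uniqueness makes it computable: two
    uniformizers differ by a unit, and no nonzero power of a uniformizer is a unit. *)
Lemma valuationE P f t u (n : int) : uniformizer P t -> u \in vunit P ->
  f = u * t ^ n -> valuation P f = n.
Proof.
move=> tP uu fE; apply: xget_unique; first by exists t, u.
move=> n' [t' [u' [t'P u'u fE']]].
have t0 := uniformizer_neq0 tP; have t'0 := uniformizer_neq0 t'P.
have [w wO t'E] := tP.2 _ t'P.1; have [w' w'O tE] := t'P.2 _ tP.1.
have w0 : w != 0 by apply: contraNneq t'0 => w0; rewrite t'E w0 mulr0.
have wu : w \in vunit P.
  rewrite vunitE w0 wO; have -> // : w^-1 = w'.
  by apply: (mulfI t'0); rewrite -tE t'E mulfK.
have : t ^ (n - n') \in vunit P.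
  have -> : t ^ (n - n') = u' * w ^ n' / u.
    rewrite expfzDr // -invr_expz; apply: (mulIf (expfz_neq0 n' t0)).
    rewrite mulfVK ?expfz_neq0 //; apply: (mulIf (vunit_neq0 uu)).
    by rewrite mulrC -fE fE' t'E expfzMl; field; rewrite (vunit_neq0 uu).
  rewrite rpred_div // rpredM //.
  by case: (n') => m; rewrite ?NegzE -?exprnN ?rpredV -?exprnP rpredX.
by move/(expz_unit_eq0 tP.1 t0)/eqP; rewrite subr_eq0 => /eqP.
Qed.

Lemma valuation_ge0 P f : f \in vring P -> 0 <= valuation P f.
Proof.
move=> fO; rewrite /valuation; case: xgetP => // n _ [t [u [tP uu fE]]].
rewrite leNgt; apply/negP => n0.
have t0 := uniformizer_neq0 tP.
case: (@vunit_maxidealF P u) => //.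
have -> : u = f * t ^ (- n) by rewrite fE -mulrA -expfzDr // subrr expr0z mulr1.
rewrite maxidealMl //; case: n n0 {fE} => // n _.
by rewrite NegzE opprK -exprnP; apply: maxidealX tP.1.
Qed.

Lemma pole_divisor_vring P f : f \in vring P -> pole_divisor f P = 0.
Proof. by move=> /valuation_ge0; rewrite /pole_divisor ltNge => ->. Qed.

Lemma place_inj P Q : (forall z, (z \in vring P) = (z \in vring Q)) -> P = Q.
Proof.
case: P Q => [OP vP] [OQ vQ] /= E; have {}E : OP = OQ by apply/funext => z; apply: E.
by move: vP; rewrite E => vP; rewrite (Prop_irrelevance vP vQ).
Qed.

End PlaceTheory.

(** * Local rings of plane models at smooth points *)

Section PlaneCoordinates.
Variables (k M : fieldType) (i : {rmorphism k -> M}) (u w : M).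
Implicit Types (P Q : place i) (z h : M) (c a b : k).

Definition coord_gens : set M := [set z | (exists c, z = i c) \/ z = u \/ z = w]%classic.

(** The ring k[[u], [w]], as an intersection of subrings, so that induction over its elements needs
    no representing polynomials. *)
Definition coord_ring : {pred M} :=
  [pred z | `[< forall A : {pred M}, subring_closed A ->
                  (forall s, coord_gens s -> s \in A) -> z \in A >]].

Fact coord_ring_subring : subring_closed coord_ring.
Proof.
split=> [|x y /asboolP xR /asboolP yR|x y /asboolP xR /asboolP yR];
  apply/asboolP => A AR As; have [A1 AB AM] := AR => //.
- by apply: AB; [apply: xR | apply: yR].
- by apply: AM; [apply: xR | apply: yR].
Qed.

HB.instance Definition _ :=
  GRing.isSubringClosed.Build M coord_ring coord_ring_subring.

Lemma coord_ring_gen z : coord_gens z -> z \in coord_ring.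
Proof. by move=> zg; apply/asboolP => A _; apply. Qed.

Lemma coord_ringC c : i c \in coord_ring.
Proof. by apply: coord_ring_gen; left; exists c. Qed.

Lemma coord_ring_l : u \in coord_ring.
Proof. by apply: coord_ring_gen; right; left. Qed.

Lemma coord_ring_r : w \in coord_ring.
Proof. by apply: coord_ring_gen; right; right. Qed.

Lemma coord_ring_ind (A : {pred M}) : subring_closed A ->
  (forall c, i c \in A) -> u \in A -> w \in A -> {subset coord_ring <= A}.
Proof.
by move=> AR Ac Au Aw z /asboolP; apply => // s [[c ->]|[->|->]].
Qed.

Lemma coord_ring_horner (p : {poly k}) : (map_poly i p).[w] \in coord_ring.
Proof.
rewrite horner_poly; apply: rpred_sum => l _.
by apply: rpredM; [apply: coord_ringC | apply/rpredX/coord_ring_r].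
Qed.

Lemma coord_ring_vring P : u \in vring P -> w \in vring P ->
  {subset coord_ring <= vring P}.
Proof.
by move=> uO wO; apply: coord_ring_ind => //; [apply: vring_subring | apply: vringC].
Qed.

Lemma coord_ring_frac : field_generated coord_gens ->
  forall z, exists h1 h2, [/\ h1 \in coord_ring, h2 \in coord_ring, h2 != 0 & z = h1 / h2].
Proof.
move=> gen z.
pose A : {pred M} := [pred z | `[< exists h1 h2,
  [/\ h1 \in coord_ring, h2 \in coord_ring, h2 != 0 & z = h1 / h2] >]].
suff /asboolP : z \in A by [].
apply: gen => [|s sg]; last first.
  by apply/asboolP; exists s, 1; rewrite coord_ring_gen ?rpred1 ?oner_eq0 ?divr1.
split=> [|x y /asboolP[h1 [h2 [h1R h2R h20 ->]]] /asboolP[l1 [l2 [l1R l2R l20 ->]]]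
         |x y /asboolP[h1 [h2 [h1R h2R h20 ->]]] /asboolP[l1 [l2 [l1R l2R l20 ->]]]];
  apply/asboolP.
- by exists 1, 1; rewrite rpred1 oner_eq0 divr1.
- exists (h1 * l2 - l1 * h2), (h2 * l2); split; rewrite ?mulf_neq0 //.
  + by apply: rpredB; apply: rpredM.
  + exact: rpredM.
  + by field; rewrite h20 l20.
- have [->|l10] := eqVneq l1 0.
    by exists 0, 1; rewrite rpred0 rpred1 oner_eq0 !mul0r invr0 mulr0.
  exists (h1 * l2), (h2 * l1); split; rewrite ?mulf_neq0 ?rpredM //.
  by field; rewrite h20 l20 l10.
Qed.

Definition eval_right : {poly k} -> M := horner_eval w \o map_poly i.
HB.instance Definition _ := GRing.RMorphism.on eval_right.

Lemma eval_rightE (p : {poly k}) : eval_right p = (map_poly i p).[w].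
Proof. by []. Qed.

Hypothesis u_int : integralOver eval_right u.

Lemma coord_ring_integral h : h \in coord_ring -> integralOver eval_right h.
Proof.
pose A : {pred M} := [pred z | `[< integralOver eval_right z >]].
move=> hR; suff /asboolP : h \in A by [].
apply: (coord_ring_ind _ _ _ _ hR) => [|c||].
- split=> [|x y /asboolP xI /asboolP yI|x y /asboolP xI /asboolP yI]; apply/asboolP.
  + exact: integral1.
  + exact: integral_sub.
  + exact: integral_mul.
- apply/asboolP; have -> : i c = eval_right c%:P by rewrite eval_rightE map_polyC hornerC.
  exact: integral_id.
- exact/asboolP.
- apply/asboolP; have -> : w = eval_right 'X by rewrite eval_rightE map_polyX hornerX.
  exact: integral_id.
Qed.

(* The constant term of an integral equation of [h], stripped of its factors
   ['X], is a multiple of [h]. *)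
Lemma coord_ring_norm h : h \in coord_ring -> h != 0 ->
  exists h' (p : {poly k}), [/\ h' \in coord_ring, h * h' = (map_poly i p).[w]
                             & (map_poly i p).[w] != 0].
Proof.
move=> hR h0; have [p pmon /rootP ph0] := coord_ring_integral hR.
have : map_poly eval_right p != 0 by apply/monic_neq0/monic_map.
have [n] := ubnP (size p); elim: n p {pmon} ph0 => // n IH p ph0 pn p0.
have pE : p = (drop_poly 1 p) * 'X + (p`_0)%:P.
  rewrite -{1}(poly_take_drop 1 p) expr1 addrC; congr (_ + _).
  by apply/polyP=> -[|l]; rewrite coef_take_poly coefC.
have peval : (map_poly eval_right (drop_poly 1 p)).[h] * h + eval_right p`_0 = 0.
  by rewrite -ph0 [in RHS]pE rmorphD rmorphM /= map_polyX map_polyC !hornerE.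
have [c0|c0] := eqVneq (eval_right p`_0) 0.
  move: peval; rewrite c0 addr0 => /eqP; rewrite mulf_eq0 (negPf h0) orbF => /eqP d0.
  apply: (IH _ d0).
    rewrite size_drop_poly; case sp: (size p) pn => [|s]; last by rewrite subn1.
    by move/eqP: sp p0; rewrite size_poly_eq0 => /eqP ->; rewrite rmorph0 eqxx.
  apply: contraNneq p0; rewrite {2}pE rmorphD rmorphM /= => ->.
  by rewrite map_polyC /= c0 mul0r add0r.
exists (- (map_poly eval_right (drop_poly 1 p)).[h]), p`_0; split=> //.
  rewrite rpredN horner_poly; apply: rpred_sum => l _.
  by apply: rpredM; [apply: coord_ring_horner | apply: rpredX].
by rewrite -eval_rightE mulrN mulrC; apply/eqP; rewrite eq_sym -addr_eq0 addrC peval.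
Qed.

Section AtPoint.
Variables (P : place i) (a b : k).
Hypothesis gen : field_generated coord_gens.
Hypotheses (ua : u - i a \in maxideal P) (wb : w - i b \in maxideal P).

Lemma coord_ring_taylor h : h \in coord_ring -> exists c h1 h2,
  [/\ h1 \in coord_ring, h2 \in coord_ring & h = i c + (u - i a) * h1 + (w - i b) * h2].
Proof.
pose A : {pred M} := [pred h | `[< exists c h1 h2,
  [/\ h1 \in coord_ring, h2 \in coord_ring & h = i c + (u - i a) * h1 + (w - i b) * h2] >]].
have uaR : u - i a \in coord_ring by rewrite rpredB ?coord_ring_l ?coord_ringC.
have wbR : w - i b \in coord_ring by rewrite rpredB ?coord_ring_r ?coord_ringC.
move=> hR; suff /asboolP : h \in A by [].
apply: (coord_ring_ind _ _ _ _ hR) => [|c||].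
- split=> [|x y /asboolP[c [h1 [h2 [h1R h2R ->]]]] /asboolP[d [l1 [l2 [l1R l2R ->]]]]
           |x y /asboolP[c [h1 [h2 [h1R h2R ->]]]] /asboolP[d [l1 [l2 [l1R l2R ->]]]]];
  apply/asboolP.
  + by exists 1, 0, 0; rewrite rpred0 rmorph1 !mulr0 !addr0.
  + exists (c - d), (h1 - l1), (h2 - l2); rewrite !rpredB //; split=> //.
    by rewrite rmorphB; ring.
  + exists (c * d), (i c * l1 + i d * h1 + (u - i a) * h1 * l1
        + (w - i b) * (h1 * l2 + h2 * l1)), (i c * l2 + i d * h2 + (w - i b) * h2 * l2).
    split; last by rewrite rmorphM; ring.
    * by rewrite !rpredD ?rpredM ?coord_ringC //; rewrite ?rpredD ?rpredM.
    * by rewrite !rpredD ?rpredM ?coord_ringC //; rewrite ?rpredD ?rpredM.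
- by apply/asboolP; exists c, 0, 0; rewrite rpred0 !mulr0 !addr0.
- by apply/asboolP; exists a, 1, 0; rewrite rpred1 rpred0; split=> //; ring.
- by apply/asboolP; exists b, 0, 1; rewrite rpred1 rpred0; split=> //; ring.
Qed.

Lemma coord_ring_in_vring : {subset coord_ring <= vring P}.
Proof. by apply: coord_ring_vring; [exact: residue_vring ua | exact: residue_vring wb]. Qed.

Variables (D G : M).
Hypotheses (DR : D \in coord_ring) (GR : G \in coord_ring).
Hypotheses (DG : (u - i a) * D = (w - i b) * G) (Du : D \in vunit P).

(** The relation [DG] encodes smoothness, [D] playing the part of a partial derivative: at the cost
    of the unit [D] it trades [u - i a] for a multiple of [w - i b]. *)
Lemma coord_ring_div h : h \in coord_ring -> h \in maxideal P ->
  exists2 h', h' \in coord_ring & h * D = (w - i b) * h'.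
Proof.
move=> hR hm; have [c [h1 [h2 [h1R h2R hE]]]] := coord_ring_taylor hR.
have c0 : c = 0.
  apply/eqP; rewrite -(constm P).
  have -> : i c = h - (u - i a) * h1 - (w - i b) * h2 by rewrite hE; ring.
  by rewrite !rpredB // maxidealMr // coord_ring_in_vring.
exists (G * h1 + D * h2); first by rewrite rpredD ?rpredM.
rewrite hE c0 rmorph0.
have -> : (0 + (u - i a) * h1 + (w - i b) * h2) * D
  = (u - i a) * D * h1 + (w - i b) * (D * h2) by ring.
by rewrite DG; ring.
Qed.

(** Since [h] divides some p([w]), the multiplicity r of [b] as a root of p bounds how often
    [w - i b] can be split off. The induction is on r, with the cofactor [h'] fixed; the factors [D]
    produced by the divisions are collected in the denominator. *)
Lemma coord_ring_order h : h \in coord_ring -> h != 0 ->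
  exists n h1 h2, [/\ h1 \in coord_ring, h2 \in coord_ring,
    h1 \in vunit P, h2 \in vunit P & h = (w - i b) ^+ n * (h1 / h2)].
Proof.
move=> hR h0; have [h' [p [h'R hh' p0]]] := coord_ring_norm hR h0.
have [r [N [NR Nu hhN]]] : exists r N,
  [/\ N \in coord_ring, N \in vunit P & h * h' = (w - i b) ^+ r * N].
  have pN0 : p != 0 by apply: contraNneq p0 => ->; rewrite rmorph0 horner0.
  have [r [s sb ps]] := multiplicity_XsubC p b.
  rewrite pN0 /= in sb.
  exists r, (map_poly i s).[w]; split; first exact: coord_ring_horner.
    suff sE : (map_poly i s).[w] - i s.[b] \in maxideal P by rewrite (residue_unit sE).
    rewrite !horner_poly -horner_map /= horner_poly -sumrB.
    apply: rpred_sum => l _; rewrite -mulrBr maxidealMl ?vringC //.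
    by rewrite -rmorphXn; apply: residueX.
  by rewrite hh' ps rmorphM rmorphXn rmorphB /= map_polyX map_polyC /= !hornerE mulrC.
elim: r h hR h0 N NR Nu {hh' p0} hhN => [|r IH] h hR h0 N NR Nu hh';
    case: (vring_dec (coord_ring_in_vring hR)) => hm.
- by exists 0%N, h, 1; rewrite !rpred1 expr0 mul1r divr1.
- case: (@vunit_maxidealF _ _ _ P N) => //.
  by rewrite -[N]mul1r -(expr0 (w - i b)) -hh' maxidealMr // coord_ring_in_vring.
- by exists 0%N, h, 1; rewrite !rpred1 expr0 mul1r divr1.
have D0 := vunit_neq0 Du.
have [l lR lE] := coord_ring_div hR hm.
have wb0 : w - i b != 0.
  by apply: contraNneq h0 => wb0; move/eqP: lE; rewrite wb0 mul0r mulf_eq0 (negPf D0) orbF.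
have l0 : l != 0.
  by apply: contraNneq h0 => l0; move/eqP: lE; rewrite l0 mulr0 mulf_eq0 (negPf D0) orbF.
have [|||n [h1 [h2 [h1R h2R h1u h2u lE']]]] := IH l lR l0 (N * D).
- exact: rpredM.
- exact: rpredM.
- apply: (mulfI wb0); rewrite [LHS]mulrA -lE mulrAC hh' exprS; ring.
exists n.+1, h1, (h2 * D); split=> //; rewrite ?rpredM //.
apply: (mulIf D0); rewrite lE lE' exprS; field.
by rewrite D0 (vunit_neq0 h2u).
Qed.

(** If [w] were the constant [i b], every nonzero element of the coordinate ring would be a unit and
    [vring P] would be the whole field. *)
Lemma local_parameter_neq0 : w - i b != 0.
Proof.
apply/eqP => wb0; case: (vringP P) => _ _ [z zO] _; apply: (negP zO).
have unit_of h : h \in coord_ring -> h != 0 -> h \in vunit P.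
  move=> hR h0; have [n [h1 [h2 [_ _ h1u h2u hE]]]] := coord_ring_order hR h0.
  move: h0; rewrite hE wb0; case: n {hE} => [_|n]; last by rewrite expr0n mul0r eqxx.
  by rewrite expr0 mul1r rpred_div.
have [h1 [h2 [h1R h2R h20 ->]]] := coord_ring_frac gen z.
have [->|h10] := eqVneq h1 0; first by rewrite mul0r rpred0.
by apply/vunitW/rpred_div; apply: unit_of.
Qed.

Lemma local_structure z : z != 0 -> exists (n : int) h1 h2,
  [/\ h1 \in coord_ring, h2 \in coord_ring,
    h1 \in vunit P, h2 \in vunit P & z = (w - i b) ^ n * (h1 / h2)].
Proof.
have [h1 [h2 [h1R h2R h20 ->]]] := coord_ring_frac gen z => z0.
have h10 : h1 != 0 by apply: contraNneq z0 => ->; rewrite mul0r.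
have [n1 [l1 [l2 [l1R l2R l1u l2u h1E]]]] := coord_ring_order h1R h10.
have [n2 [r1 [r2 [r1R r2R r1u r2u h2E]]]] := coord_ring_order h2R h20.
exists (n1%:Z - n2%:Z), (l1 * r2), (l2 * r1); split; rewrite ?rpredM //.
have t0 := local_parameter_neq0.
rewrite h1E h2E expfzDr // -exprnP -exprnN; field.
by rewrite !(vunit_neq0 l2u, vunit_neq0 r2u, vunit_neq0 r1u) expf_neq0.
Qed.

Lemma local_vring z n h1 h2 : h1 \in vunit P -> h2 \in vunit P ->
  z = (w - i b) ^ n * (h1 / h2) -> (z \in vring P) = (0 <= n).
Proof.
move=> h1u h2u zE; have t0 := local_parameter_neq0.
have hO : h1 / h2 \in vunit P by rewrite rpred_div.
case: n zE => n zE.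
  by rewrite zE -exprnP rpredM ?rpredX ?(maxidealW wb) ?(vunitW hO).
apply/negbTE; have := maxidealV_notin (maxidealX (ltn0Sn n) wb).
rewrite expf_eq0 t0 => /(_ isT); apply: contra => zO.
have -> : (w - i b) ^- n.+1 = z / (h1 / h2).
  rewrite zE NegzE -exprnN mulfK //; exact: vunit_neq0 hO.
by rewrite rpredM // vunitW // rpredV.
Qed.

Lemma local_uniformizer : uniformizer P (w - i b).
Proof.
split=> // z zm; have [->|z0] := eqVneq z 0; first by exists 0; rewrite ?rpred0 ?mulr0.
have [n [h1 [h2 [_ _ h1u h2u zE]]]] := local_structure z0.
have hu : h1 / h2 \in vunit P by rewrite rpred_div.
have := maxidealW zm; rewrite (local_vring h1u h2u zE).
case: n zE => [[|n]|n] // zE _.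
  by case: (vunit_maxidealF _ zm); rewrite zE expr0z mul1r.
exists ((w - i b) ^+ n * (h1 / h2)); last by rewrite mulrA -exprS.
by rewrite rpredM ?rpredX ?(maxidealW wb) ?vunitW.
Qed.

Lemma coord_ring_residue h : h \in coord_ring -> exists c, h - i c \in maxideal P.
Proof.
move=> /coord_ring_taylor[c [h1 [h2 [h1R h2R ->]]]]; exists c.
have -> : i c + (u - i a) * h1 + (w - i b) * h2 - i c
  = (u - i a) * h1 + (w - i b) * h2 by ring.
by rewrite rpredD // maxidealMr // coord_ring_in_vring.
Qed.

Lemma local_degree_one : degree_one P.
Proof.
move=> z zO; have [->|z0] := eqVneq z 0; first by exists 0; rewrite rmorph0 subrr maxideal0.
have [n [h1 [h2 [h1R h2R h1u h2u zE]]]] := local_structure z0.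
move: zO; rewrite (local_vring h1u h2u zE) zE.
have [c1 hc1] := coord_ring_residue h1R; have [c2 hc2] := coord_ring_residue h2R.
case: n {zE} => // n _; exists (0 ^+ n * (c1 / c2)); rewrite -exprnP.
apply: residueM; last by apply: residueM => //; apply: residueV => //; rewrite -(residue_unit hc2).
by apply: residueX; rewrite rmorph0 subr0.
Qed.

End AtPoint.

(** Residues of elements of the coordinate ring depend only on the centre, hence so do the units
    among them; by [local_structure] these decide membership in the valuation ring. *)
Lemma place_of_center (P Q : place i) a b D G : field_generated coord_gens ->
  u - i a \in maxideal P -> w - i b \in maxideal P ->
  u - i a \in maxideal Q -> w - i b \in maxideal Q ->
  D \in coord_ring -> G \in coord_ring ->
  (u - i a) * D = (w - i b) * G -> D \in vunit P -> P = Q.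
Proof.
move=> gen uaP wbP uaQ wbQ DR GR DG DuP.
have unitPQ h : h \in coord_ring -> h \in vunit P -> h \in vunit Q.
  move=> hR; have [c [h1 [h2 [h1R h2R hE]]]] := coord_ring_taylor a b hR.
  have res (R : place i) : u - i a \in maxideal R -> w - i b \in maxideal R ->
      h - i c \in maxideal R.
    move=> ua wb; have RO := coord_ring_in_vring ua wb.
    have -> : h - i c = (u - i a) * h1 + (w - i b) * h2 by rewrite hE; ring.
    by rewrite rpredD // maxidealMr // RO.
  by rewrite (residue_unit (res P uaP wbP)) (residue_unit (res Q uaQ wbQ)).
have DuQ := unitPQ D DR DuP.
apply: place_inj => z; have [->|z0] := eqVneq z 0; first by rewrite !rpred0.
have [n [h1 [h2 [h1R h2R h1u h2u zE]]]] := local_structure gen uaP wbP DR GR DG DuP z0.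
rewrite (local_vring gen uaP wbP DR GR DG DuP h1u h2u zE).
by rewrite (local_vring gen uaQ wbQ DR GR DG DuQ (unitPQ _ h1R h1u) (unitPQ _ h2R h2u) zE).
Qed.

End PlaneCoordinates.

(** Otherwise every linear factor of a polynomial in [w] is a unit, so every nonzero polynomial in
    [w] is one; rationalising denominators by norms then puts the whole field into [vring P]. *)
Lemma residue_exists (k : closedFieldType) (M : fieldType) (i : {rmorphism k -> M})
    (u w : M) (P : place i) :
  integralOver (eval_right i w) u -> field_generated (coord_gens i u w) ->
  u \in vring P -> w \in vring P -> exists b, w - i b \in maxideal P.
Proof.
move=> u_int gen uO wO; apply: contrapT => nb.
have unit_of (p : {poly k}) : (map_poly i p).[w] != 0 -> (map_poly i p).[w] \in vunit P.
  have [r ->] := closed_field_poly_normal p.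
  rewrite linearZ /= hornerZ mulf_eq0 negb_or fmorph_eq0 => /andP[c0 _].
  apply: rpredM; first exact: vunitC.
  elim: r => [|b r IH]; first by rewrite big_nil rmorph1 hornerC rpred1.
  rewrite big_cons rmorphM hornerM; apply: rpredM => //.
  rewrite rmorphB /= map_polyX map_polyC /= !hornerE.
  have wbO : w - i b \in vring P by rewrite rpredB // vringC.
  by case: (vring_dec wbO) => // wbm; case: nb; exists b.
have RO := coord_ring_vring uO wO.
case: (vringP P) => _ _ [z zO] _; apply: (negP zO).
have [h1 [h2 [h1R h2R h20 ->]]] := coord_ring_frac gen z.
have [h' [p [h'R hh' p0]]] := coord_ring_norm u_int h2R h20.
have h'0 : h' != 0 by apply: contraNneq p0 => h'0; rewrite -hh' h'0 mulr0.
have -> : h1 / h2 = h1 * h' / (h2 * h') by field; rewrite h20 h'0.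
apply: rpredM; first by rewrite rpredM ?RO.
by rewrite vunitW // hh' rpredV unit_of.
Qed.

(** * Generators, contraction of places and the relations between x, y and z *)

Section FieldClosure.
Variables (M : fieldType) (S : set M).

Definition field_closure : {pred M} :=
  [pred z | `[< forall A : {pred M}, divring_closed A ->
                  (forall s, S s -> s \in A) -> z \in A >]].

Fact field_closure_divring : divring_closed field_closure.
Proof.
split=> [|x y /asboolP xR /asboolP yR|x y /asboolP xR /asboolP yR];
  apply/asboolP => A AR As; have [A1 AB AM] := AR => //.
- by apply: AB; [apply: xR | apply: yR].
- by apply: AM; [apply: xR | apply: yR].
Qed.

HB.instance Definition _ :=
  GRing.isDivringClosed.Build M field_closure field_closure_divring.

Lemma field_closure_gen z : S z -> z \in field_closure.
Proof. by move=> zS; apply/asboolP => A _; apply. Qed.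

Lemma field_closure_full : (forall z, z \in field_closure) -> field_generated S.
Proof. by move=> full A AR As z; have /asboolP := full z; apply. Qed.

End FieldClosure.

Lemma field_generated_coord (k M : fieldType) (i : {rmorphism k -> M}) (u w u' w' : M) :
  field_generated (coord_gens i u w) ->
  u \in field_closure (coord_gens i u' w') ->
  w \in field_closure (coord_gens i u' w') ->
  field_generated (coord_gens i u' w').
Proof.
move=> gen uA wA; apply: field_closure_full => z.
apply: gen z => [|s [[c ->]|[->|->]]] //; first exact: field_closure_divring.
by apply: field_closure_gen; left; exists c.
Qed.

Lemma field_closure_l (k M : fieldType) (i : {rmorphism k -> M}) (u w : M) :
  u \in field_closure (coord_gens i u w).
Proof. by apply: field_closure_gen; right; left. Qed.

Lemma field_closure_r (k M : fieldType) (i : {rmorphism k -> M}) (u w : M) :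
  w \in field_closure (coord_gens i u w).
Proof. by apply: field_closure_gen; right; right. Qed.

(** The list of pairs (coefficient, exponent) lets an integral equation be given by its few lower
    terms. *)
Lemma integral_monic_eq (R M : comNzRingType) (f : {rmorphism R -> M}) (u : M) n
    (s : seq (R * nat)) :
  all (fun ak => ak.2 < n)%N s -> u ^+ n + \sum_(ak <- s) f ak.1 * u ^+ ak.2 = 0 ->
  integralOver f u.
Proof.
move=> sn ur; pose r : {poly R} := \sum_(ak <- s) ak.1 *: 'X^(ak.2).
exists ('X^n + r).
  rewrite monicE lead_coefDl ?lead_coefXn // size_polyXn ltnS.
  rewrite /r big_seq; apply: (big_ind (fun p : {poly R} => size p <= n)%N).
  - by rewrite size_poly0.
  - by move=> p p' pn p'n; apply: leq_trans (size_polyD _ _) _; rewrite geq_max pn.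
  - move=> ak aks; apply: leq_trans (size_scale_leq _ _) _; rewrite size_polyXn.
    exact: (allP sn).
rewrite /root rmorphD /= map_polyXn !hornerE /r rmorph_sum horner_sum.
rewrite -[X in _ == X]ur; apply/eqP; congr (_ + _); apply: eq_bigr => ak _.
by rewrite /= map_polyZ map_polyXn hornerZ hornerXn.
Qed.

Section Contraction.
Variables (F K Y L : fieldType) (iFK : {rmorphism F -> K}) (iFY : {rmorphism F -> Y}).
Variables (iKL : {rmorphism K -> L}) (iYL : {rmorphism Y -> L}).
Hypothesis compat : forall c, iKL (iFK c) = iYL (iFY c).
Variable P : place iKL.

Lemma contraction_valuation_ring : (exists z, iYL z \notin vring P) ->
  is_valuation_ring iFY [pred z | iYL z \in vring P].
Proof.
move=> [z0 z0O]; split.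
- split=> [|x y|x y]; rewrite !inE ?rmorph1 ?rpred1 // => xO yO.
  + by rewrite rmorphB rpredB.
  + by rewrite rmorphM rpredM.
- by move=> c; rewrite inE -compat vringC.
- by exists z0.
- by move=> z; rewrite !inE fmorphV vring_total.
Qed.

Lemma contraction_place : (exists z, iYL z \notin vring P) ->
  exists P' : place iFY, [/\ forall z, (z \in vring P') = (iYL z \in vring P),
    forall z, (z \in vunit P') = (iYL z \in vunit P)
  & forall z, (z \in maxideal P') = (iYL z \in maxideal P)].
Proof.
move=> nontriv; pose P' := Place (contraction_valuation_ring nontriv).
have P'O z : (z \in vring P') = (iYL z \in vring P) by [].
have P'u z : (z \in vunit P') = (iYL z \in vunit P).
  by rewrite !vunitE !P'O fmorph_eq0 fmorphV.
by exists P'; split=> // z; rewrite !maxidealE P'O P'u.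
Qed.

(** The chart and its centre are defined over [F], so the contraction of [P] to [Y] is centred at
    the same smooth point and has degree one. That [w] is not constant makes the contraction
    nontrivial. *)
Lemma rational_of_chart (u w : Y) (a b : F) (D G : Y) :
  integralOver (eval_right iFY w) u -> field_generated (coord_gens iFY u w) ->
  iYL (u - iFY a) \in maxideal P -> iYL (w - iFY b) \in maxideal P -> w != iFY b ->
  D \in coord_ring iFY u w -> G \in coord_ring iFY u w ->
  (u - iFY a) * D = (w - iFY b) * G -> iYL D \in vunit P ->
  rational_place iFY iYL P.
Proof.
move=> u_int gen ua wb wNb DR GR DG Du.
have [|P' [P'O P'u P'm]] := contraction_place.
  exists (w - iFY b)^-1; rewrite fmorphV; apply: maxidealV_notin => //.
  by rewrite fmorph_eq0 subr_eq0.
exists P'; split=> [|z]; last exact: P'O.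
by apply: (local_degree_one u_int gen _ _ DR GR DG); rewrite ?P'm ?P'u.
Qed.

End Contraction.

(** Adjoining z gives two relations stable under an involution ([Y3_dual]), and each place where z
    is finite has a smooth chart among the pairs (x, y), (z, y), (z, x). *)
Definition Y3_triple (M : fieldType) (m : nat) (x y z : M) : Prop :=
  [/\ x != 0, y != 0, z != 0, z * y = x ^+ 3 & x * (z ^+ m + 1) = y ^+ m.+1].

Lemma Y3_triple_map (M M' : fieldType) (f : {rmorphism M -> M'}) m (x y z : M) :
  Y3_triple m x y z -> Y3_triple m (f x) (f y) (f z).
Proof.
move=> [x0 y0 z0 zy E]; split; rewrite ?fmorph_eq0 // -?rmorphXn -?rmorphM ?zy // -E.
by rewrite rmorphM rmorphD rmorph1.
Qed.

Section Triple.
Variables (M : fieldType) (m : nat) (x y z : M).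

Lemma Y3_triple_of_curve : x != 0 -> y != 0 ->
  x ^+ (3 * m).+1 + x * y ^+ m - y ^+ (2 * m).+1 = 0 -> Y3_triple m x y (x ^+ 3 / y).
Proof.
move=> x0 y0 E; split=> //; first by rewrite mulf_neq0 ?expf_neq0 ?invr_eq0.
  by rewrite divfK.
apply: (mulIf (expf_neq0 m y0)); rewrite -exprD.
have -> : (m.+1 + m = (2 * m).+1)%N by lia.
move/eqP: E; rewrite subr_eq0 => /eqP <-.
rewrite exprMn exprVn -exprM exprS mulrDr mulr1 mulrDl; congr (_ + _).
by rewrite -mulrA mulfVK ?expf_neq0.
Qed.

Hypothesis xyz : Y3_triple m x y z.

(** Induced by (s, t) |-> (1/s, t/s) on the Hermitian curve. It exchanges the origin and the place
    at infinity, so only one of them needs a chart. *)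
Lemma Y3_dual : Y3_triple m (x / z) (y / z) z^-1.
Proof.
have [x0 y0 z0 zy E] := xyz.
split; rewrite ?mulf_neq0 ?invr_eq0 //.
  by rewrite expr_div_n -zy; field.
rewrite expr_div_n -E exprVn exprS; field.
by rewrite z0 expf_neq0.
Qed.

Lemma Y3_curve : x ^+ (3 * m).+1 + x * y ^+ m = y ^+ (2 * m).+1.
Proof.
have [x0 y0 z0 zy E] := xyz.
have -> : ((2 * m).+1 = m.+1 + m)%N by lia.
by rewrite exprD -E exprS exprM -zy exprMn; ring.
Qed.

(** The cube of the Hermitian equation, written in s^3 and t^3. Likewise [Y3_norm_x] is that
    equation multiplied by s^(q+1). *)
Lemma Y3_norm_y : z * (z ^+ m + 1) ^+ 3 = y ^+ (3 * m).+2.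
Proof.
have [x0 y0 z0 zy E] := xyz; apply: (mulIf y0).
rewrite mulrAC zy -exprMn E -exprM -exprSr; congr (_ ^+ _); lia.
Qed.

Lemma Y3_norm_x : z ^+ m.+1 * (z ^+ m + 1) = x ^+ (3 * m).+2.
Proof.
have [x0 y0 z0 zy E] := xyz; apply: (mulIf x0).
rewrite -mulrA [(_ + 1) * x]mulrC E -exprMn zy -exprM -exprSr; congr (_ ^+ _); lia.
Qed.

Lemma Y3_neq0 : z ^+ m + 1 != 0.
Proof.
have [_ y0 _ _ E] := xyz; apply: contraTneq (expf_neq0 m.+1 y0) => zm.
by rewrite -E zm mulr0 eqxx.
Qed.

Lemma Y3_x : z ^+ m + 1 != 0 -> x = y ^+ m.+1 / (z ^+ m + 1).
Proof. by move=> n0; have [_ _ _ _ <-] := xyz; rewrite mulfK. Qed.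

Section Constants.
Variables (k : fieldType) (i : {rmorphism k -> M}).
Hypothesis m0 : (0 < m)%N.

Let evalE (w : M) (p : {poly k}) : eval_right i w p = (map_poly i p).[w].
Proof. by []. Qed.

Let evalXn w l : eval_right i w 'X^l = w ^+ l.
Proof. by rewrite evalE map_polyXn hornerXn. Qed.

Let evalX w : eval_right i w 'X = w.
Proof. by rewrite evalE map_polyX hornerX. Qed.

Lemma Y3_integral_xy : integralOver (eval_right i y) x.
Proof.
apply: (@integral_monic_eq _ _ _ _ (3 * m).+1 [:: ('X^m, 1%N); (- 'X^((2 * m).+1), 0%N)]).
  by rewrite /= ltnS muln_gt0 m0.
by rewrite !big_cons big_nil /= rmorphN /= !evalXn; rewrite -Y3_curve; ring.
Qed.

Lemma Y3_integral_yx : integralOver (eval_right i x) y.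
Proof.
apply: (@integral_monic_eq _ _ _ _ (2 * m).+1 [:: (- 'X, m); (- 'X^((3 * m).+1), 0%N)]).
  by rewrite /= andbT ltnS; lia.
by rewrite !big_cons big_nil /= !rmorphN /= evalX !evalXn -Y3_curve; ring.
Qed.

Lemma Y3_integral_yz : integralOver (eval_right i z) y.
Proof.
apply: (@integral_monic_eq _ _ _ _ (3 * m).+2 [:: (- ('X * ('X^m + 1) ^+ 3), 0%N)]) => //.
rewrite !big_cons big_nil /= -Y3_norm_y.
by rewrite rmorphN rmorphM rmorphXn rmorphD rmorph1 /= evalX evalXn; ring.
Qed.

Lemma Y3_integral_zx : integralOver (eval_right i x) z.
Proof.
apply: (@integral_monic_eq _ _ _ _ (2 * m).+1 [:: (1, m.+1); (- 'X^((3 * m).+2), 0%N)]).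
  by rewrite /= andbT; lia.
rewrite !big_cons big_nil /= rmorphN rmorph1 /= evalXn -Y3_norm_x.
by have -> : ((2 * m).+1 = m.+1 + m)%N; [lia | rewrite exprD; ring].
Qed.

Lemma Y3_integral_zy : integralOver (eval_right i y) z.
Proof.
apply: (@integral_monic_eq _ _ _ _ (3 * m).+1
  [:: (3%:R, (2 * m).+1); (3%:R, m.+1); (1, 1%N); (- 'X^((3 * m).+2), 0%N)]).
  by rewrite /= andbT; lia.
rewrite !big_cons big_nil /= rmorphN rmorph1 !rmorph_nat /= evalXn -Y3_norm_y.
by rewrite !exprS mulnC exprM mulnC exprM; ring.
Qed.

Lemma Y3_gen_yx : field_generated (coord_gens i x y) -> field_generated (coord_gens i y x).
Proof.
by move=> gen; apply: (field_generated_coord gen); [apply: field_closure_r | apply: field_closure_l].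
Qed.

Lemma Y3_gen_zx : field_generated (coord_gens i x y) -> field_generated (coord_gens i z x).
Proof.
move=> gen; apply: (field_generated_coord gen); first exact: field_closure_r.
have [_ _ z0 zy _] := xyz; rewrite -[y](mulKf z0) zy mulrC.
by rewrite rpred_div ?rpredX ?field_closure_l ?field_closure_r.
Qed.

End Constants.

Section AtPlace.
Variables (k : fieldType) (i : {rmorphism k -> M}) (P : place i).
Hypothesis m0 : (0 < m)%N.

Lemma Y3_vring : z \in vring P -> x \in vring P /\ y \in vring P.
Proof.
move=> zO; have [_ _ _ zy _] := xyz.
have yO : y \in vring P.
  apply: (@vring_expI _ _ _ P _ (3 * m).+2) => //.
  by rewrite -Y3_norm_y rpredM ?rpredX ?rpredD ?rpredX ?rpred1.
by split=> //; apply: (@vring_expI _ _ _ P _ 3) => //; rewrite -zy rpredM.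
Qed.

Lemma Y3_maxideal : z \in maxideal P -> x \in maxideal P /\ y \in maxideal P.
Proof.
move=> zm; have zO := maxidealW zm; have [_ _ _ zy _] := xyz.
have ym : y \in maxideal P.
  apply: (@maxideal_expI _ _ _ P _ (3 * m).+2) => //.
  by rewrite -Y3_norm_y maxidealMr ?rpredX ?rpredD ?rpredX ?rpred1.
split=> //; apply: (@maxideal_expI _ _ _ P _ 3) => //; rewrite -zy maxidealMr //.
exact: maxidealW.
Qed.
End AtPlace.
End Triple.

(** * Rational places *)

(** The difference quotient of X^n, which specialises to the derivative when both arguments have the
    same residue. *)
Definition geom_sum (M : nzRingType) n (u v : M) : M :=
  \sum_(l < n) u ^+ (n.-1 - l) * v ^+ l.

Lemma geom_sum_residue (k M : fieldType) (i : {rmorphism k -> M}) (P : place i) n u a :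
  u - i a \in maxideal P -> geom_sum n u (i a) - i (n%:R * a ^+ n.-1) \in maxideal P.
Proof.
move=> ua; rewrite mulr_natl -[n in _ *+ n]card_ord -sumr_const rmorph_sum -sumrB.
apply: rpred_sum => l _.
have -> : n.-1 = (n.-1 - l + l)%N by have := ltn_ord l; lia.
rewrite addnK exprD; apply: residueM; first exact: residueX.
by rewrite -rmorphXn residueC.
Qed.

Lemma subrXX_geom (M : comNzRingType) n (u v : M) :
  u ^+ n - v ^+ n = (u - v) * geom_sum n u v.
Proof. by rewrite subrXX. Qed.

Lemma rpred_geom_sum (M : nzRingType) (A : subringClosed M) n u v :
  u \in A -> v \in A -> geom_sum n u v \in A.
Proof. by move=> uA vA; apply: rpred_sum => l _; rewrite rpredM ?rpredX. Qed.

Section AffineChart.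
Variables (k M : fieldType) (i : {rmorphism k -> M}) (m : nat) (x y z : M).
Hypothesis xyz : Y3_triple m x y z.
Hypothesis char_q : (3 * m).+1%:R = 0 :> k.
Variables (P : place i) (a b : k).
Hypotheses (xa : x - i a \in maxideal P) (yb : y - i b \in maxideal P).

Lemma Y3_center : a ^+ (3 * m).+1 + a * b ^+ m = b ^+ (2 * m).+1.
Proof.
apply: (@residue_uniq _ _ _ P (y ^+ (2 * m).+1)); last exact: residueX.
rewrite -(Y3_curve xyz); apply: residueD; first exact: residueX.
by apply: residueM => //; apply: residueX.
Qed.

(** As q vanishes in [k], the partial derivative in x of the curve equation is y^m, a unit once [b]
    is nonzero. [D] and [G] are the corresponding difference quotients. *)
Lemma Y3_chart : b != 0 -> exists D G, [/\ D \in coord_ring i x y, G \in coord_ring i x y,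
  (x - i a) * D = (y - i b) * G & D \in vunit P].
Proof.
move=> b0; pose q := (3 * m).+1.
have xR := coord_ring_l i x y; have yR := coord_ring_r i x y.
exists (geom_sum q x (i a) + y ^+ m),
  (geom_sum (2 * m).+1 y (i b) - i a * geom_sum m y (i b)); split.
- by rewrite rpredD ?rpredX ?rpred_geom_sum ?coord_ringC.
- by rewrite rpredB ?rpredM ?rpred_geom_sum ?coord_ringC.
- rewrite mulrDr -subrXX_geom mulrBr -subrXX_geom mulrCA -subrXX_geom.
  rewrite -(Y3_curve xyz) -!rmorphXn -Y3_center rmorphD rmorphM /q; ring.
- have Dc : geom_sum q x (i a) + y ^+ m - i (q%:R * a ^+ q.-1 + b ^+ m) \in maxideal P.
    by apply: residueD; [apply: geom_sum_residue | apply: residueX].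
  by rewrite (residue_unit Dc) char_q mul0r add0r expf_neq0.
Qed.

End AffineChart.

Section Rational.
Variables (F K Y L : fieldType) (iFK : {rmorphism F -> K}) (iFY : {rmorphism F -> Y}).
Variables (iKL : {rmorphism K -> L}) (iYL : {rmorphism Y -> L}).
Hypothesis compat : forall c, iKL (iFK c) = iYL (iFY c).
Variables (P : place iKL) (m : nat).
Hypothesis m0 : (0 < m)%N.
Hypothesis char_q : (3 * m).+1%:R = 0 :> F.

(** In z (z^m + 1)^3 = y^(q+1) the cofactor of z is a unit where z vanishes, so (z, y) is a smooth
    chart with local parameter y. *)
Lemma rational_origin (x y z : Y) : Y3_triple m x y z ->
  field_generated (coord_gens iFY x y) -> iYL z \in maxideal P ->
  rational_place iFY iYL P.
Proof.
move=> xyz gen zm; have [x0 y0 z0 zy E] := xyz.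
have yL := Y3_triple_map iYL xyz.
have [xm ym] := Y3_maxideal yL zm.
have Du : iYL ((z ^+ m + 1) ^+ 3) \in vunit P.
  rewrite rmorphXn rmorphD rmorph1 rmorphXn addrC rpredX //.
  by rewrite vunitDm ?rpred1 // maxidealX.
have zm1 := Y3_neq0 xyz.
have zR := coord_ring_l iFY z y; have yR := coord_ring_r iFY z y.
apply: (@rational_of_chart _ _ _ _ _ _ _ _ compat P z y 0 0
  ((z ^+ m + 1) ^+ 3) (y ^+ (3 * m).+1)).
- exact: (Y3_integral_zy xyz).
- apply: (field_generated_coord gen); last exact: field_closure_r.
  rewrite (Y3_x xyz zm1) rpred_div ?rpredX ?rpredD ?rpredX ?rpred1 //.
    exact: field_closure_r.
  exact: field_closure_l.
- by rewrite rmorph0 subr0.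
- by rewrite rmorph0 subr0.
- by rewrite rmorph0.
- by rewrite rpredX ?rpredD ?rpredX ?rpred1.
- by rewrite rpredX.
- by rewrite rmorph0 !subr0 (Y3_norm_y xyz) -exprS.
- by [].
Qed.

Lemma rational_infinity (x y z : Y) : Y3_triple m x y z ->
  field_generated (coord_gens iFY x y) -> iYL z \notin vring P ->
  rational_place iFY iYL P.
Proof.
move=> xyz gen zO; have [x0 y0 z0 zy _] := xyz.
apply: (@rational_origin (x / z) (y / z) z^-1); first exact: Y3_dual.
  have XA := field_closure_l iFY (x / z) (y / z).
  have YA := field_closure_r iFY (x / z) (y / z).
  have zA : z \in field_closure (coord_gens iFY (x / z) (y / z)).
    have zE : (y / z) / (x / z) ^+ 3 = z by rewrite expr_div_n -zy; field; rewrite y0 z0.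
    by have := rpred_div YA (rpredX 3 XA); rewrite zE.
  apply: (field_generated_coord gen).
    by have := rpredM XA zA; rewrite divfK.
  by have := rpredM YA zA; rewrite divfK.
by rewrite fmorphV maxidealV.
Qed.

(** These common zeros of x and y all collapse to the singular origin of the (x, y)-plane. The
    coordinate z separates them: m is invertible in [F], so z^m + 1 has simple roots and (z, x) is a
    smooth chart. *)
Lemma rational_node (x y z : Y) (c : F) : Y3_triple m x y z ->
  field_generated (coord_gens iFY x y) -> c ^+ m = -1 ->
  iYL z - iKL (iFK c) \in maxideal P ->
  rational_place iFY iYL P.
Proof.
move=> xyz gen cm zc; have [x0 y0 z0 zy E] := xyz.
have c0 : c != 0.
  by apply: contra_eq_neq cm => ->; rewrite expr0n gtn_eqF // eq_sym oppr_eq0 oner_eq0.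
have mF0 : m%:R != 0 :> F.
  apply: contra_eq_neq char_q => mF; rewrite -addn1 natrD natrM mF mulr0 add0r oner_eq0 //.
have zR := coord_ring_l iFY z x; have xR := coord_ring_r iFY z x.
have fK0 d : (iFK d == 0) = (d == 0) by rewrite fmorph_eq0.
have zmE : z ^+ m + 1 = (z - iFY c) * geom_sum m z (iFY c).
  by rewrite -subrXX_geom -rmorphXn cm rmorphN1 opprK.
have gE : iYL (geom_sum m z (iFY c)) = geom_sum m (iYL z) (iKL (iFK c)).
  by rewrite /geom_sum rmorph_sum; apply: eq_bigr => l _; rewrite rmorphM !rmorphXn compat.
have xm : iYL x \in maxideal P.
  apply: (@maxideal_expI _ _ _ P _ (3 * m).+2) => //.
  rewrite -rmorphXn -(Y3_norm_x xyz) rmorphM maxidealMl //.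
    by rewrite rmorphXn rpredX // (residue_vring zc).
  rewrite rmorphD rmorph1 rmorphXn.
  have -> : iYL z ^+ m + 1 = iYL z ^+ m - iKL (iFK c ^+ m).
    by rewrite -(rmorphXn iFK) cm !rmorphN1 opprK.
  exact: residueX.
apply: (@rational_of_chart _ _ _ _ _ _ _ _ compat P z x c 0
   (z ^+ m.+1 * geom_sum m z (iFY c)) (x ^+ (3 * m).+1)).
- exact: (Y3_integral_zx xyz).
- exact: (Y3_gen_zx xyz).
- by rewrite rmorphB -compat.
- by rewrite rmorph0 subr0.
- by rewrite rmorph0.
- by rewrite rpredM ?rpredX ?rpred_geom_sum ?coord_ringC.
- by rewrite rpredX.
- by rewrite rmorph0 subr0 mulrCA -zmE (Y3_norm_x xyz) -exprS.
- rewrite rmorphM gE rmorphXn.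
  have Dc := residueM (residueX m.+1 zc) (geom_sum_residue m zc).
  rewrite (residue_unit Dc) -!rmorphXn -(rmorph_nat iFK) -!rmorphM fK0.
  by rewrite !mulf_neq0 ?expf_neq0.
Qed.

Lemma rational_affine (x y z : Y) (a b : F) : Y3_triple m x y z ->
  field_generated (coord_gens iFY x y) -> ~ algebraicOver iFY x -> b != 0 ->
  iYL x - iKL (iFK a) \in maxideal P -> iYL y - iKL (iFK b) \in maxideal P ->
  rational_place iFY iYL P.
Proof.
move=> xyz gen xtr b0 xa yb.
have yNb : y != iFY b.
  apply/eqP => yE; apply: xtr; apply/integral_algebraic.
  apply: (@integral_monic_eq _ _ _ _ (3 * m).+1
    [:: (b ^+ m, 1%N); (- b ^+ (2 * m).+1, 0%N)]).
    by rewrite /= ltnS muln_gt0 m0.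
  rewrite !big_cons big_nil /= rmorphN !rmorphXn -yE /= -(Y3_curve xyz); ring.
have [|P' [P'O P'u P'm]] := @contraction_place _ _ _ _ _ _ _ _ compat P.
  exists (y - iFY b)^-1; rewrite fmorphV; apply: maxidealV_notin.
    by rewrite rmorphB -compat.
  by rewrite fmorph_eq0 subr_eq0.
have xa' : x - iFY a \in maxideal P' by rewrite P'm rmorphB -compat.
have yb' : y - iFY b \in maxideal P' by rewrite P'm rmorphB -compat.
have [D [G [DR GR DG Du]]] := Y3_chart xyz char_q xa' yb' b0.
exists P'; split=> [|w]; last exact: P'O.
exact: (local_degree_one (Y3_integral_xy xyz iFY m0) gen xa' yb' DR GR DG).
Qed.

End Rational.

(** * Congruences and local Hermitian coordinates *)

Section Congruence.
Variables (k M : fieldType) (i : {rmorphism k -> M}) (P : place i).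
Implicit Types a b c d e : M.

(** Congruence modulo [d] O_P. The witness, in place of a quotient by [d], keeps the notion
    meaningful for [d] = 0; this matters when [d] is the value of a tangent line not yet known to be
    nonzero. *)
Definition cong d a b : Prop := exists2 r, r \in vring P & a - b = d * r.

Lemma cong_refl d a : cong d a a.
Proof. by exists 0; rewrite ?rpred0 // subrr mulr0. Qed.

Lemma cong_sym d a b : cong d a b -> cong d b a.
Proof. by move=> [r rO E]; exists (- r); rewrite ?rpredN // mulrN -E opprB. Qed.

Lemma cong_trans d b a c : cong d a b -> cong d b c -> cong d a c.
Proof.
move=> [r rO E] [r' r'O E']; exists (r + r'); first by rewrite rpredD.
by rewrite mulrDr -E -E' addrA subrK.
Qed.

Lemma congD d a b a' b' : cong d a b -> cong d a' b' -> cong d (a + a') (b + b').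
Proof.
move=> [r rO E] [r' r'O E']; exists (r + r'); first by rewrite rpredD.
by rewrite mulrDr -E -E' opprD addrACA.
Qed.

Lemma congN d a b : cong d a b -> cong d (- a) (- b).
Proof. by move=> [r rO E]; exists (- r); rewrite ?rpredN // mulrN -E opprB opprK addrC. Qed.

Lemma congB d a b a' b' : cong d a b -> cong d a' b' -> cong d (a - a') (b - b').
Proof. by move=> ab ab'; apply/congD/congN. Qed.

Lemma congM d a b a' b' : a \in vring P -> b' \in vring P ->
  cong d a b -> cong d a' b' -> cong d (a * a') (b * b').
Proof.
move=> aO b'O [r rO E] [r' r'O E'].
exists (a * r' + r * b'); first by rewrite rpredD ?rpredM.
have -> : a * a' - b * b' = a * (a' - b') + (a - b) * b' by ring.
by rewrite E E'; ring.
Qed.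

Lemma congMl d c a b : c \in vring P -> cong d a b -> cong d (c * a) (c * b).
Proof.
by move=> cO [r rO E]; exists (c * r); rewrite ?rpredM // -mulrBr E mulrCA.
Qed.

Lemma congX d a b n : a \in vring P -> b \in vring P -> cong d a b -> cong d (a ^+ n) (b ^+ n).
Proof.
move=> aO bO ab; elim: n => [|n IH]; first exact: cong_refl.
by rewrite !exprS; apply: congM => //; rewrite rpredX.
Qed.

Lemma cong_sum d (I : Type) (s : seq I) (f g : I -> M) :
  (forall l, cong d (f l) (g l)) -> cong d (\sum_(l <- s) f l) (\sum_(l <- s) g l).
Proof.
move=> fg; elim: s => [|l s IH]; first by rewrite !big_nil; apply: cong_refl.
by rewrite !big_cons; apply: congD.
Qed.

Lemma cong_cancel d c a b : c \in vunit P -> cong d (c * a) (c * b) -> cong d a b.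
Proof.
move=> cu [r rO E]; exists (r / c); first by rewrite rpredM // vunitW // rpredV.
by rewrite mulrA -E -mulrBr mulrAC mulfV ?mul1r // (vunit_neq0 cu).
Qed.

(* Newton iteration for [X^3 - y] starting at [t0]. *)
Lemma cube_root_approx y t0 : 3%:R != 0 :> k -> t0 != 0 ->
  y - i (t0 ^+ 3) \in maxideal P -> forall n, exists theta,
  theta - i t0 \in maxideal P /\ cong ((y - i (t0 ^+ 3)) ^+ n.+1) (theta ^+ 3) y.
Proof.
move=> c3 t00 ym; set t := y - _ in ym *; have tO := maxidealW ym.
elim=> [|n [theta [tm [r rO E]]]].
  exists (i t0); split; first exact: residueC.
  by exists (-1); rewrite ?rpredN1 // /t rmorphXn; ring.
have thO := residue_vring tm.
have tu : 3%:R * theta ^+ 2 \in vunit P.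
  rewrite -(rmorph_nat i) rpredM ?vunitC // rpredX //.
  by rewrite (residue_unit tm).
pose e := r / (3%:R * theta ^+ 2).
have eO : e \in vring P by rewrite rpredM // vunitW // rpredV.
pose ep := t ^+ n.+1 * e.
have ethE : theta ^+ 3 - y = 3%:R * theta ^+ 2 * ep.
  have := vunit_neq0 tu; rewrite mulf_eq0 expf_eq0 negb_or /= => /andP[M3 th0].
  by rewrite E /ep /e; field; rewrite M3 th0.
exists (theta - ep); split.
  rewrite addrAC rpredB // /ep maxidealMr // maxidealX //.
exists (t ^+ n * e ^+ 2 * (3%:R * theta - ep)).
  have epO : ep \in vring P by rewrite rpredM ?rpredX.
  by apply: rpredM; [rewrite rpredM ?rpredX | apply: rpredB => //; rewrite rpredM ?rpred_nat].
have -> : (theta - ep) ^+ 3 - y = (theta ^+ 3 - y) - 3%:R * theta ^+ 2 * ep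
   + ep ^+ 2 * (3%:R * theta - ep) by ring.
by rewrite ethE subrr add0r /ep; rewrite !exprS; ring.
Qed.

(** An approximate point of the Hermitian curve with coordinates in [M]: [theta] stands for t, and
    [sigma] imitates s = (st) t^2 / t^3. *)
Lemma hermitian_approx (m : nat) (x y z : M) (s0 t0 : k) : Y3_triple m x y z ->
  3%:R != 0 :> k -> t0 != 0 ->
  x - i (s0 * t0) \in maxideal P -> y - i (t0 ^+ 3) \in maxideal P ->
  forall n (d := (y - i (t0 ^+ 3)) ^+ n.+2), exists theta (sigma := x / y * theta ^+ 2),
  [/\ theta - i t0 \in maxideal P, sigma - i s0 \in maxideal P,
      (exists2 e, e \in vunit P & theta - i t0 = (y - i (t0 ^+ 3)) * e)
    & [/\ cong d (theta ^+ 3) y, cong d (sigma * theta) x, cong d (sigma ^+ 3) z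
        & cong d (sigma ^+ (3 * m).+1 + sigma) (theta ^+ (3 * m).+2)]].
Proof.
move=> xyz c3 t00 xs yt n d; have [x0 y0 z0 zy xzy] := xyz.
have [theta [th0 thy]] := cube_root_approx c3 t00 yt n.+1.
have thO := residue_vring th0; have xO := residue_vring xs; have yO := residue_vring yt.
have thu : theta \in vunit P by rewrite (residue_unit th0).
have yu : y \in vunit P by rewrite (residue_unit yt) expf_neq0.
have yVO : y^-1 \in vring P by rewrite vunitW // rpredV.
have xyO : x / y \in vring P by rewrite rpredM.
have dm : d \in maxideal P by rewrite maxidealX.
exists theta; set sigma := x / y * theta ^+ 2.
have sO : sigma \in vring P by rewrite rpredM ?rpredX.
have s0m : sigma - i s0 \in maxideal P.
  have -> : s0 = s0 * t0 / t0 ^+ 3 * t0 ^+ 2 by field.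
  by apply: residueM; [apply: residueM => //; apply: residueV; rewrite ?expf_neq0 | apply: residueX].
have sx : cong d (sigma * theta) x.
  have -> : sigma * theta = x / y * theta ^+ 3 by rewrite /sigma; ring.
  by rewrite -{2}[x](divfK y0); apply: congMl.
have zE : z = x ^+ 3 / y by rewrite -zy mulfK.
have zO : z \in vring P by rewrite zE rpredM ?rpredX.
have sz : cong d (sigma ^+ 3) z.
  have -> : sigma ^+ 3 = x ^+ 3 / y ^+ 3 * (theta ^+ 3) ^+ 2.
    by rewrite /sigma; field.
  have -> : z = x ^+ 3 / y ^+ 3 * y ^+ 2 by rewrite zE; field.
  apply: congMl; last by apply: congX; rewrite ?rpredX.
  by rewrite rpredM ?rpredX // -exprVn rpredX.
have herm : cong d (sigma ^+ (3 * m).+1 + sigma) (theta ^+ (3 * m).+2).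
  (* Multiplied by [theta], the Hermitian relation becomes x (z^m + 1) = y^(m+1). *)
  apply: (cong_cancel thu).
  have -> : theta * (sigma ^+ (3 * m).+1 + sigma)
    = (sigma * theta) * ((sigma ^+ 3) ^+ m + 1) by rewrite exprS exprM; ring.
  have -> : theta * theta ^+ (3 * m).+2 = (theta ^+ 3) ^+ m.+1.
    by rewrite -exprM mulnS -exprS.
  apply: (@cong_trans _ (y ^+ m.+1)); last by apply/cong_sym/congX; rewrite ?rpredX.
  rewrite -xzy; apply: congM => //; rewrite ?rpredM ?rpredD ?rpredX ?rpred1 //.
  by apply: congD; [apply: congX; rewrite ?rpredX | apply: cong_refl].
split=> //.
have [r rO E] := thy.
pose t := y - i (t0 ^+ 3).
pose w := theta ^+ 2 + theta * i t0 + i t0 ^+ 2.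
have wu : w \in vunit P.
  have wc : w - i (t0 ^+ 2 + t0 * t0 + t0 ^+ 2) \in maxideal P.
    rewrite /w -rmorphXn; apply: residueD; last exact: residueC.
    by apply: residueD; [apply: residueX | apply: residueM => //; apply: residueC].
  rewrite (residue_unit wc); have -> : t0 ^+ 2 + t0 * t0 + t0 ^+ 2 = 3%:R * t0 ^+ 2 by ring.
  by rewrite mulf_neq0 ?expf_neq0.
(* The precision is at least t^2, so the error still contains a factor t after t is split off; this
   keeps the cofactor a unit. *)
exists ((1 + t ^+ n.+1 * r) / w).
  by rewrite rpred_div // vunitDm ?rpred1 // maxidealMr // maxidealX.
apply: (mulIf (vunit_neq0 wu)); rewrite -mulrA divfK ?(vunit_neq0 wu) //.
have -> : (theta - i t0) * w = (theta ^+ 3 - y) + t by rewrite /w /t rmorphXn; ring.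
by rewrite E -/t !exprS; ring.
Qed.

End Congruence.

(** * The invariant form with prescribed contact *)

(* For [h] in [M[T]], the trace of [h(t)] from [M(t)], [t^3 = y], down to [M]. *)
Definition trace3 (M : fieldType) (y : M) (h : {poly M}) : M :=
  \sum_(n < size h) (if (3 %| n)%N then 3%:R * h`_n * y ^+ (n %/ 3) else 0).

Section Trace.
Variables (k M : fieldType) (i : {rmorphism k -> M}) (P : place i).

(** Summing over the three conjugates of [theta] kills the exponents not divisible by 3; in the
    others [theta ^+ 3] may be replaced by y. *)
Lemma trace3_cong d y theta (h : {poly M}) (w : M) : w ^+ 3 = 1 -> 1 + w + w ^+ 2 = 0 ->
  theta \in vring P -> y \in vring P -> (forall n, h`_n \in vring P) ->
  cong P d (theta ^+ 3) y ->
  cong P d (h.[theta] + h.[w * theta] + h.[w ^+ 2 * theta]) (trace3 y h).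
Proof.
move=> w3 w1 thO yO hO thy; rewrite !horner_coef -!big_split /=.
apply: cong_sum => n.
have -> : h`_n * theta ^+ n + h`_n * (w * theta) ^+ n + h`_n * (w ^+ 2 * theta) ^+ n
  = h`_n * (1 + w ^+ n + (w ^+ n) ^+ 2) * theta ^+ n.
  by rewrite !exprMn; ring.
case: ifP => [/dvdnP[l nl]|n3].
  have wn : w ^+ n = 1 by rewrite nl mulnC exprM w3 expr1n.
  have -> : h`_n * (1 + w ^+ n + (w ^+ n) ^+ 2) * theta ^+ n
      = 3%:R * h`_n * (theta ^+ 3) ^+ l.
    by rewrite wn -exprM mulnC -nl; ring.
  have -> : (n %/ 3 = l)%N by rewrite nl mulnK.
  apply: congMl; first by rewrite rpredM ?rpred_nat.
  by apply: congX; rewrite ?rpredX.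
have -> : 1 + w ^+ n + (w ^+ n) ^+ 2 = 0.
  rewrite (divn_eq n 3) exprD [(_ * 3)%N]mulnC exprM w3 expr1n mul1r.
  move: n3; rewrite /dvdn; case: (n %% 3)%N (ltn_pmod n (isT : (0 < 3)%N)) => [|[|[|]]] // _ _.
  have -> : (w ^+ 2) ^+ 2 = w ^+ 3 * w by ring.
  by rewrite w3 mul1r -w1; ring.
rewrite mulr0 mul0r; exact: cong_refl.
Qed.

(* Membership after taking cubes describes integrality with respect to the
   extension of the valuation to [M(y^(1/3))]. *)
Lemma cube_vringD e a b : a ^+ 3 * e \in vring P -> b ^+ 3 * e \in vring P ->
  (a + b) ^+ 3 * e \in vring P.
Proof.
have aux c d : c ^+ 3 * e \in vring P -> d != 0 -> d / c \in vring P ->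
    c != 0 -> (c + d) ^+ 3 * e \in vring P.
  move=> cO d0 dcO c0.
  have -> : (c + d) ^+ 3 * e = (1 + d / c) ^+ 3 * (c ^+ 3 * e) by field.
  by rewrite rpredM // rpredX // rpredD ?rpred1.
have [->|a0] := eqVneq a 0; first by rewrite add0r.
have [->|b0] := eqVneq b 0; first by rewrite addr0.
move=> aO bO; have [ab|ba] := orP (vring_total P (a / b)).
  by rewrite addrC; apply: aux.
by apply: aux => //; move: ba; rewrite invf_div.
Qed.

Lemma cube_vring_sum e (I : Type) (s : seq I) (Q : pred I) (f : I -> M) :
  (forall l, Q l -> f l ^+ 3 * e \in vring P) -> (\sum_(l <- s | Q l) f l) ^+ 3 * e \in vring P.
Proof.
move=> fO; apply: (big_ind (fun a => a ^+ 3 * e \in vring P)) => //.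
  by rewrite expr0n mul0r rpred0.
by move=> a b; apply: cube_vringD.
Qed.

(** Termwise integrality of e^(1/3) h(y^(1/3)), stated on cubes; the weight [e] records the pole
    that is allowed. *)
Definition twisted_integral (y e : M) (h : {poly M}) : Prop :=
  forall n, h`_n ^+ 3 * (y ^+ n * e) \in vring P.

Lemma twisted_integralD y e g h : twisted_integral y e g -> twisted_integral y e h ->
  twisted_integral y e (g + h).
Proof. by move=> gO hO n; rewrite coefD; apply: cube_vringD. Qed.

Lemma twisted_integralM y e e' g h : twisted_integral y e g -> twisted_integral y e' h ->
  twisted_integral y (e * e') (g * h).
Proof.
move=> gO hO n; rewrite coefM; apply: cube_vring_sum => l _.
have -> : (g`_l * h`_(n - l)) ^+ 3 * (y ^+ n * (e * e'))
  = (g`_l ^+ 3 * (y ^+ l * e)) * (h`_(n - l) ^+ 3 * (y ^+ (n - l) * e')).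
  have -> : y ^+ n = y ^+ l * y ^+ (n - l) by rewrite -exprD subnKC // -ltnS.
  by ring.
by rewrite rpredM.
Qed.

Lemma twisted_integralC y c : twisted_integral y 1 (i c)%:P.
Proof.
move=> [|n]; rewrite coefC /= ?expr0 ?mulr1 ?rpredX ?vringC //.
by rewrite expr0n mul0r rpred0.
Qed.

Lemma twisted_integralZ y e c h : twisted_integral y e h ->
  twisted_integral y e ((i c)%:P * h).
Proof.
by move=> hO; rewrite -[e]mul1r; apply: twisted_integralM => //; apply: twisted_integralC.
Qed.

Lemma twisted_integralX y e h n : twisted_integral y e h ->
  twisted_integral y (e ^+ n) (h ^+ n).
Proof.
move=> hO; elim: n => [|n IH]; last by rewrite !exprS; apply: twisted_integralM.
by rewrite !expr0; have := @twisted_integralC y 1; rewrite rmorph1.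
Qed.

Lemma trace3_integral y e h : twisted_integral y e h -> trace3 y h ^+ 3 * e \in vring P.
Proof.
move=> hO; apply: cube_vring_sum => n _; case: ifP => [/dvdnP[l nl]|_].
  have -> : (3%:R * h`_n * y ^+ (n %/ 3)) ^+ 3 * e = 3%:R ^+ 3 * (h`_n ^+ 3 * (y ^+ n * e)).
    have -> : (n %/ 3 = l)%N by rewrite nl mulnK.
    have -> : y ^+ n = (y ^+ l) ^+ 3 by rewrite -exprM -nl.
    by ring.
  by rewrite rpredM ?rpredX ?rpred_nat.
by rewrite expr0n mul0r rpred0.
Qed.

End Trace.

(* [tangent A B w t s] is the equation [A + s - B t] of the tangent line, precomposed
   with the deck transformation [(s, t) |-> (w^2 s, w t)]. *)
Definition tangent (M : pzRingType) (A B w t s : M) : M := A - w * B * t + w ^+ 2 * s.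

(* Values of the conjugates [tangent A B w] and [tangent A B (w ^+ 2)] at the point of
   the line [A + s = B t] with parameter [t]. *)
Definition conj1 (M : pzRingType) (w A B t : M) : M := A * (1 - w ^+ 2) + (w ^+ 2 - w) * B * t.
Definition conj2 (M : pzRingType) (w A B t : M) : M := A * (1 - w) + (w - w ^+ 2) * B * t.

Section CyclicForms.
Variables (M : comNzRingType) (w A B : M).
Hypotheses (w3 : w ^+ 3 = 1) (w1 : 1 + w + w ^+ 2 = 0).

(** On the line X_0 = 0, the pencil spanned by the two other lines has a member vanishing at the
    parameter [r]. It is a multiple of t - r by a constant independent of [r]. *)
Lemma conj_lines_comb t s r :
  conj2 w A B r * tangent A B w t s - conj1 w A B r * tangent A B (w ^+ 2) t s
  = 3%:R * A * B * (w ^+ 2 - w) * (t - r)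
    + tangent A B 1 t s * (conj2 w A B r * w ^+ 2 - conj1 w A B r * w).
Proof.
have w4 : (w ^+ 2) ^+ 2 = w by rewrite -[RHS]mul1r -w3; ring.
apply/eqP; rewrite -subr_eq0; apply/eqP.
transitivity (- A * B * (w ^+ 2 - w) * (t - r) * (1 + w + w ^+ 2)); last by rewrite w1 mulr0.
rewrite /tangent w4 /conj1 /conj2; ring.
Qed.

(** The factorisation of a^3 + b^3 + c^3 - 3abc over the cube roots of unity, at a = A, b = s, c =
    -Bt. *)
Lemma tangent_norm t s :
  tangent A B 1 t s * (tangent A B w t s * tangent A B (w ^+ 2) t s)
  = s ^+ 3 + A ^+ 3 - B ^+ 3 * t ^+ 3 + 3%:R * (A * B) * (s * t).
Proof.
have w4 : (w ^+ 2) ^+ 2 = w by rewrite -[RHS]mul1r -w3; ring.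
have -> : tangent A B w t s * tangent A B (w ^+ 2) t s
  = A ^+ 2 + s ^+ 2 + (B * t) ^+ 2 + A * (B * t) - A * s + s * (B * t).
  apply/eqP; rewrite -subr_eq0; apply/eqP.
  transitivity ((1 + w + w ^+ 2) * ((w - 1) * (s ^+ 2 + (B * t) ^+ 2) - A * (B * t) + A * s
     - s * (B * t) * (w ^+ 2 - w + 1))); last by rewrite w1 mul0r.
  rewrite /tangent w4; ring.
rewrite /tangent; ring.
Qed.

End CyclicForms.

Lemma tangent_vring (k M : fieldType) (i : {rmorphism k -> M}) (P : place i) (a b c t s : M) :
  a \in vring P -> b \in vring P -> c \in vring P -> t \in vring P -> s \in vring P ->
  tangent a b c t s \in vring P.
Proof.
move=> aO bO cO tO sO.
by rewrite /tangent; apply: rpredD; [apply: rpredB => //|]; rewrite !rpredM ?rpredX.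
Qed.

(** A binary form in two of the lines. With (u, v) and (u', v') their values at the parameters t0
    and t1, the product has the wanted zeros on the third line; the term in [g] is a correction at a
    vertex. *)
Definition pair_form (M : pzRingType) (u v u' v' g : M) e (p r : M) : M :=
  (v * p - u * r) ^+ e * (v' * p - u' * r) - g * p ^+ e.+1.

Lemma horner_pair_form (M : comNzRingType) (u v u' v' g a : M) e (p r : {poly M}) :
  (pair_form u%:P v%:P u'%:P v'%:P g%:P e p r).[a] = pair_form u v u' v' g e p.[a] r.[a].
Proof. by rewrite /pair_form !hornerE. Qed.

(** Modulo [l0] there remain h(l1, l2), h(l2, 0) and h(0, l1). The choice g = v^e v' makes h(l2, 0)
    vanish, and [node] makes h(0, l1) equal to g l1^(e+1), exactly what h(l1, l2) had subtracted. *)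
Lemma pair_form_cyclic (k M : fieldType) (i : {rmorphism k -> M}) (P : place i)
    (u v u' v' l0 l1 l2 : M) e :
  all (mem (vring P)) [:: u; v; u'; v'; l0; l1; l2] ->
  v ^+ e * v' = (- u) ^+ e * (- u') ->
  let h := pair_form u v u' v' (v ^+ e * v') e in
  cong P l0 (h l1 l2 + h l2 l0 + h l0 l1) ((v * l1 - u * l2) ^+ e * (v' * l1 - u' * l2)).
Proof.
move=> /and5P[uO vO u'O v'O /and4P[l0O l1O l2O _]] node h.
have c0 a : a \in vring P -> cong P l0 (l0 * a) 0.
  by move=> aO; exists a; rewrite // subr0.
have h20 : cong P l0 (h l2 l0) 0.
  rewrite /h /pair_form.
  have -> : 0 = (v * l2 - 0) ^+ e * (v' * l2 - 0) - v ^+ e * v' * l2 ^+ e.+1.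
    by rewrite !subr0 exprMn exprS; ring.
  have lin a b : a \in vring P -> b \in vring P -> cong P l0 (a * l2 - b * l0) (a * l2 - 0).
    by move=> aO bO; apply: congB; [apply: cong_refl | rewrite mulrC; apply: c0].
  apply: congB; last exact: cong_refl.
  apply: congM; [| |apply: congX|exact: lin]; rewrite ?rpredX ?rpredB ?rpredM ?rpred0 //.
  exact: lin.
have h01 : cong P l0 (h l0 l1) (v ^+ e * v' * l1 ^+ e.+1).
  rewrite /h /pair_form.
  have -> : v ^+ e * v' * l1 ^+ e.+1
     = (0 - u * l1) ^+ e * (0 - u' * l1) - 0.
    by rewrite node !sub0r subr0 -!mulNr exprMn exprS; ring.
  have lin a b : a \in vring P -> b \in vring P -> cong P l0 (a * l0 - b * l1) (0 - b * l1).
    by move=> aO bO; apply: congB; [rewrite mulrC; apply: c0 | apply: cong_refl].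
  apply: congB; last first.
    by rewrite exprS mulrCA; apply: c0; rewrite !rpredM ?rpredX.
  apply: congM; [| |apply: congX|exact: lin]; rewrite ?rpredX ?rpredB ?rpredM ?rpred0 //.
  exact: lin.
set G := _ ^+ e * _.
have -> : G = h l1 l2 + 0 + v ^+ e * v' * l1 ^+ e.+1 by rewrite /h /pair_form /G; ring.
by do 2!apply: congD => //; apply: cong_refl.
Qed.

Section SpecialFunction.
Variables (k M : fieldType) (i : {rmorphism k -> M}).
Variables (m : nat) (x y z : M) (w A B t0 t1 : k) (e : nat).
Hypothesis xyz : Y3_triple m x y z.
Hypotheses (w3 : w ^+ 3 = 1) (w1 : 1 + w + w ^+ 2 = 0).

Definition tangent_plane : M :=
  z + i (A ^+ 3) - i (B ^+ 3) * y + i (3%:R * (A * B)) * x.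

(** A conjugate tangent line as a polynomial in T, with s eliminated. The deck transformation
    becomes a scaling of T ([line_poly_conj]), so the trace produces a cyclic sum. *)
Definition line_poly (c : k) : {poly M} :=
  (i A)%:P - (i (c * B))%:P * 'X + (i (c ^+ 2))%:P * ((x / y)%:P * 'X^2).

Let u := conj1 w A B t0.
Let v := conj2 w A B t0.
Let u' := conj1 w A B t1.
Let v' := conj2 w A B t1.

(* The term in [v ^+ e * v'] cancels the values of the other conjugates of the
   product, so that the trace restricts to that product on the tangent line. *)
Definition pair_poly : {poly M} :=
  pair_form (i u)%:P (i v)%:P (i u')%:P (i v')%:P (i (v ^+ e * v'))%:P e
    (line_poly w) (line_poly (w ^+ 2)).

Definition contact_form : M := trace3 y pair_poly.

(** Applied with [d] = 1 where z is finite and with [d] = 1/z elsewhere. The weighted cubes of the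
    coefficients of a line are constant multiples of d, y d and z d, whence the three hypotheses;
    degree e + 1 in the lines gives the exponent of [d]. *)
Lemma contact_form_integral (P : place i) (d : M) : d \in vring P ->
  y * d \in vring P -> z * d \in vring P -> contact_form ^+ 3 * d ^+ e.+1 \in vring P.
Proof.
move=> dO ydO zdO; apply: trace3_integral.
have [x0 y0 _ zy _] := xyz.
have lineO c : twisted_integral P y d (line_poly c).
  apply: twisted_integralD; first apply: twisted_integralD.
  - move=> [|n]; rewrite coefC /=; first by rewrite mul1r rpredM ?rpredX ?vringC.
    by rewrite expr0n mul0r rpred0.
  - rewrite -mulNr -polyCN -rmorphN; apply: twisted_integralZ.
    move=> n; rewrite coefX; case: n => [|[|n]] /=; rewrite ?expr0n ?mul0r ?rpred0 //.
    by rewrite expr1n mul1r expr1.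
  - apply: twisted_integralZ => n; rewrite coefCM coefXn.
    case: eqP => [->|_]; last by rewrite mulr0 expr0n mul0r rpred0.
    have -> : (x / y * 1) ^+ 3 * (y ^+ 2 * d) = z * d.
      by rewrite mulr1 expr_div_n -zy; field.
    by [].
have pairO a b : twisted_integral P y d ((i a)%:P * line_poly w - (i b)%:P * line_poly (w ^+ 2)).
  apply: twisted_integralD; first exact: twisted_integralZ.
  by rewrite -mulNr -polyCN -rmorphN; apply: twisted_integralZ.
apply: twisted_integralD.
  by rewrite exprSr; apply: twisted_integralM => //; apply: twisted_integralX.
by rewrite -mulNr -polyCN -rmorphN; apply/twisted_integralZ/twisted_integralX.
Qed.

Lemma line_poly_eval c th : (line_poly c).[th] = tangent (i A) (i B) (i c) th (x / y * th ^+ 2).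
Proof. by rewrite /line_poly /tangent !hornerE rmorphM rmorphXn. Qed.

Lemma line_poly_conj c c' th :
  (line_poly c).[i c' * th] = tangent (i A) (i B) (i (c' * c)) th (x / y * th ^+ 2).
Proof. by rewrite line_poly_eval /tangent !rmorphM; ring. Qed.

Lemma pair_poly_conj c th (l := fun a => tangent (i A) (i B) (i a) th (x / y * th ^+ 2)) :
  pair_poly.[i c * th]
  = pair_form (i u) (i v) (i u') (i v') (i v ^+ e * i v') e (l (c * w)) (l (c * w ^+ 2)).
Proof.
by rewrite horner_pair_form !line_poly_conj (rmorphM i (v ^+ e)) (rmorphXn i).
Qed.

Hypothesis node : v ^+ e * v' = (- u) ^+ e * (- u').

(** At an approximate cube root the trace is the cyclic sum of [pair_poly], which modulo the tangent
    line reduces to a product of pencil members vanishing e times at t0 and once at t1. *)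
Lemma contact_form_cong (P : place i) d th :
  th \in vring P -> y \in vring P -> x / y \in vring P -> cong P d (th ^+ 3) y ->
  exists2 r, r \in vring P &
  cong P d contact_form
    (i ((3%:R * A * B * (w ^+ 2 - w)) ^+ e.+1) * ((th - i t0) ^+ e * (th - i t1))
     + tangent (i A) (i B) 1 th (x / y * th ^+ 2) * r).
Proof.
move=> thO yO xyO thy; set s := x / y * _.
have sO : s \in vring P by rewrite rpredM ?rpredX.
pose l a := tangent (i A) (i B) (i a) th s.
have lO a : l a \in vring P.
  by rewrite tangent_vring ?vringC.
have iw3 : i w ^+ 3 = 1 by rewrite -rmorphXn w3 rmorph1.
have iw1 : 1 + i w + i w ^+ 2 = 0 by rewrite -rmorphXn -(rmorph1 i) -!rmorphD w1 rmorph0.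
have lineP c : line_poly c \is a polyOver (vring P).
  rewrite /line_poly; apply: rpredD; first apply: rpredB.
  - by rewrite polyOverC vringC.
  - by rewrite rpredM ?polyOverX // polyOverC vringC.
  - by rewrite !rpredM ?rpredX ?polyOverX // polyOverC ?vringC.
have pairP a b : (i a)%:P * line_poly w - (i b)%:P * line_poly (w ^+ 2)
    \is a polyOver (vring P).
  by apply: rpredB; rewrite rpredM // polyOverC vringC.
have polyO n : pair_poly`_n \in vring P.
  apply/polyOverP: n; apply: rpredB; first by rewrite rpredM ?rpredX.
  by rewrite rpredM ?rpredX // polyOverC vringC.
have tr := trace3_cong iw3 iw1 thO yO polyO thy.
have cyc : cong P (l 1) (pair_poly.[th] + pair_poly.[i w * th] + pair_poly.[i w ^+ 2 * th])
   ((i v * l w - i u * l (w ^+ 2)) ^+ e * (i v' * l w - i u' * l (w ^+ 2))).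
  have -> : pair_poly.[th] = pair_poly.[i 1 * th] by rewrite rmorph1 mul1r.
  rewrite -rmorphXn !pair_poly_conj -/s !mul1r.
  have -> : w * w = w ^+ 2 by [].
  have -> : w * w ^+ 2 = 1 by rewrite -exprS.
  have -> : w ^+ 2 * w = 1 by rewrite -exprSr.
  have -> : w ^+ 2 * w ^+ 2 = w by rewrite -[RHS]mul1r -w3; ring.
  apply: pair_form_cyclic; first by rewrite /= !vringC !lO.
  by rewrite -!rmorphN -!rmorphXn -!rmorphM node.
pose c := 3%:R * A * B * (w ^+ 2 - w).
have comb r : cong P (l 1) (i (conj2 w A B r) * l w - i (conj1 w A B r) * l (w ^+ 2))
    (i c * (th - i r)).
  have := conj_lines_comb (i A) (i B) iw3 iw1 th s (i r).
  have -> : conj2 (i w) (i A) (i B) (i r) = i (conj2 w A B r).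
    by rewrite /conj2 !(rmorphD, rmorphM, rmorphN, rmorph1, rmorphXn).
  have -> : conj1 (i w) (i A) (i B) (i r) = i (conj1 w A B r).
    by rewrite /conj1 !(rmorphD, rmorphM, rmorphN, rmorph1, rmorphXn).
  have -> : 3%:R * i A * i B * (i w ^+ 2 - i w) = i c.
    by rewrite /c !(rmorphD, rmorphM, rmorphN, rmorph1, rmorphXn, rmorph_nat).
  rewrite /l rmorph1 rmorphXn => ->.
  exists (i (conj2 w A B r) * i w ^+ 2 - i (conj1 w A B r) * i w); last by ring.
  by rewrite rpredB // rpredM ?rpredX ?vringC.
have thcO r : i c * (th - i r) \in vring P by rewrite rpredM ?rpredB ?vringC.
have combO r : i (conj2 w A B r) * l w - i (conj1 w A B r) * l (w ^+ 2) \in vring P.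
  by rewrite rpredB // rpredM ?vringC.
have cyc2 := cong_trans cyc (congM (rpredX e (combO t0)) (thcO t1)
  (congX e (combO t0) (thcO t0) (comb t0)) (comb t1)).
have [r rO E] := cyc2; exists r => //.
apply: (cong_trans (cong_sym tr)).
suff -> : pair_poly.[th] + pair_poly.[i w * th] + pair_poly.[i w ^+ 2 * th]
    = i (c ^+ e.+1) * ((th - i t0) ^+ e * (th - i t1)) + tangent (i A) (i B) 1 th s * r.
  exact: cong_refl.
move: E => /eqP; rewrite subr_eq => /eqP ->; rewrite addrC /l rmorph1.
by rewrite rmorphXn !exprMn exprS; congr (_ + _); ring.
Qed.

End SpecialFunction.

(** * Expansions at P and at its Frobenius image *)

Lemma pnat_pchar_fmorph (k M : fieldType) (i : {rmorphism k -> M}) n :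
  [pchar k].-nat n -> [pchar M].-nat n.
Proof. by move=> kn; rewrite (eq_pnat _ (fmorph_pchar i)). Qed.

Section LocalExpansion.
Variables (k M : fieldType) (i : {rmorphism k -> M}).
Variables (m : nat) (x y z : M) (w s0 t0 : k) (e : nat).
Let q := (3 * m).+1.
Hypothesis m0 : (0 < m)%N.
Hypothesis xyz : Y3_triple m x y z.
Hypotheses (w3 : w ^+ 3 = 1) (w1 : 1 + w + w ^+ 2 = 0).
Hypothesis char_q : [pchar k].-nat q.
Hypothesis k3 : 3%:R != 0 :> k.
Hypothesis herm0 : s0 ^+ q + s0 = t0 * t0 ^+ q.
Hypotheses (s00 : s0 != 0) (t00 : t0 != 0).
Let A := s0 ^+ q.
Let B := t0 ^+ q.
Let t1 := B ^+ q.
Let u := conj1 w A B t0.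
Let v := conj2 w A B t0.
Let u' := conj1 w A B t1.
Let v' := conj2 w A B t1.
Hypothesis node : v ^+ e * v' = (- u) ^+ e * (- u').

Let pi := tangent_plane i x y z A B.
Let f0 := contact_form i x y w A B t0 t1 e.

(** Treats P and Phi(P) together, (s', t') being a point of the tangent line. [l0] is the tangent at
    the approximate point and [W] the product of its conjugates. Adding [l0 ^+ q] to [l0] turns the
    Hermitian equation into a factorised expression in t alone, which yields the order of [l0]. *)
Lemma local_expansion (P : place i) (s' t' : k) n : A + s' = B * t' -> t' != 0 ->
  conj1 w A B t' != 0 -> conj2 w A B t' != 0 ->
  x - i (s' * t') \in maxideal P -> y - i (t' ^+ 3) \in maxideal P ->
  let t := y - i (t' ^+ 3) in let d := t ^+ n.+2 in
  exists th l0 W, [/\ th - i t' \in maxideal P,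
      (exists2 c, c \in vunit P & th - i t' = t * c),
      l0 \in maxideal P, W \in vunit P & [/\ cong P d pi (l0 * W),
      cong P d (l0 + l0 ^+ q) ((th - i t1) * (th - i t0) ^+ q)
    & exists2 r, r \in vring P & cong P d f0
        (i ((3%:R * A * B * (w ^+ 2 - w)) ^+ e.+1) * ((th - i t0) ^+ e * (th - i t1))
         + l0 * r)]].
Proof.
move=> st t'0 u0 v0 xs yt t d.
have [th [thm sm thE [thy sx sz herm]]] := hermitian_approx xyz k3 t'0 xs yt n.
set s := x / y * th ^+ 2 in sm sx sz herm.
have thO := residue_vring thm; have sO := residue_vring sm.
have yu : y \in vunit P by rewrite (residue_unit yt) expf_neq0.
have yO := vunitW yu; have xO := residue_vring xs.
have xyO : x / y \in vring P by rewrite rpredM // vunitW // rpredV.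
have M_q : [pchar M].-nat q by apply: pnat_pchar_fmorph char_q.
have iw3 : i w ^+ 3 = 1 by rewrite -rmorphXn w3 rmorph1.
have iw1 : 1 + i w + i w ^+ 2 = 0 by rewrite -rmorphXn -(rmorph1 i) -!rmorphD w1 rmorph0.
pose l (c : M) := tangent (i A) (i B) c th s.
have lres c : l (i c) - i (tangent A B c t' s') \in maxideal P.
  rewrite /l /tangent -(rmorphM i c) -rmorphXn.
  by apply: residueD; [apply: residueB; first exact: residueC | ];
    apply: residueM => //; apply: residueC.
have s'E : s' = B * t' - A by rewrite -st; ring.
have w4 : (w ^+ 2) ^+ 2 = w by rewrite -[RHS]mul1r -w3; ring.
exists th, (l 1), (l (i w) * l (i w ^+ 2)); split=> //.
- have := lres 1; rewrite rmorph1 => l1.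
  by rewrite (residue_max l1) /tangent s'E expr1n; apply/eqP; ring.
- have lwm := lres w; have lw2 := lres (w ^+ 2); rewrite rmorphXn in lw2.
  rewrite rpredM //.
    by rewrite (residue_unit lwm) (_ : tangent _ _ _ _ _ = conj1 w A B t') //
       /tangent /conj1 s'E; ring.
  by rewrite (residue_unit lw2) (_ : tangent _ _ _ _ _ = conj2 w A B t') //
       /tangent /conj2 w4 s'E; ring.
- split.
  + rewrite /l (tangent_norm _ _ iw3 iw1) /pi /tangent_plane.
    apply: congD; last first.
      rewrite !rmorphM rmorph_nat; apply: congMl; last exact: cong_sym.
      by rewrite !rpredM ?rpred_nat ?vringC.
    apply: congB; last first.
      by rewrite rmorphXn; apply: congMl; [rewrite rpredX ?vringC | apply: cong_sym].
    by rewrite rmorphXn; apply: congD; [apply: cong_sym | apply: cong_refl].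
  + have lq : l 1 ^+ q = i A ^+ q - i B ^+ q * th ^+ q + s ^+ q.
      rewrite /l /tangent expr1n !mul1r !(exprDn_pchar _ _ M_q) (exprNn_pchar _ M_q).
      by rewrite exprMn.
    have AB : i A + i A ^+ q = i B * i t1.
      rewrite -rmorphXn -rmorphD -rmorphM /t1 /A -[X in _ + X]/((s0 ^+ q) ^+ q).
      by rewrite addrC -(exprDn_pchar _ _ char_q) herm0 exprMn.
    have -> : (th - i t1) * (th - i t0) ^+ q
      = th ^+ (3 * m).+2 + (i B * i t1 - i B * th - i t1 * th ^+ q).
      rewrite (exprDn_pchar _ _ M_q) (exprNn_pchar _ M_q) -(rmorphXn i q) -/B exprS; ring.
    have -> : l 1 + l 1 ^+ q = (s ^+ q + s) + (i B * i t1 - i B * th - i t1 * th ^+ q).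
      by rewrite lq -AB /l /tangent /t1 (rmorphXn i q B); ring.
    by apply: congD; [exact: herm | exact: cong_refl].
  + have := contact_form_cong w3 w1 node thO yO xyO thy; exact.
Qed.

Hypothesis w0 : w ^+ 2 - w != 0.
Hypothesis t10 : t1 != t0.

Let const_neq0 : (3%:R * A * B * (w ^+ 2 - w)) ^+ e.+1 != 0.
Proof. by rewrite expf_neq0 // !mulf_neq0 ?expf_neq0. Qed.

Let unit_factor (P : place i) l : l \in maxideal P -> 1 + l ^+ (3 * m) \in vunit P.
Proof.
by move=> lm; rewrite vunitDm ?rpred1 // maxidealX // muln_gt0.
Qed.

Lemma expansion_at_point (P : place i) : u != 0 -> v != 0 -> (e < q)%N ->
  x - i (s0 * t0) \in maxideal P -> y - i (t0 ^+ 3) \in maxideal P ->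
  (exists2 U, U \in vunit P & pi = (y - i (t0 ^+ 3)) ^+ q * U) /\
  (exists2 V, V \in vunit P & f0 = (y - i (t0 ^+ 3)) ^+ e * V).
Proof.
move=> u0 v0 eq xs yt; set t := y - _ in yt *; have tO := maxidealW yt.
have line0 : A + s0 = B * t0 by rewrite /A herm0 mulrC.
(* The precision is t^(3m+2) = t^(q+1), one more than the order q to be detected. *)
have [th [l0 [W [thm [c cu thE] lm Wu [[r2 r2O pE] [r1 r1O lE] [r rO [r3 r3O fE]]]]]]] :=
  local_expansion (3 * m) line0 t00 u0 v0 xs yt.
rewrite -/t in thE pE lE fE.
have cO := vunitW cu; have WO := vunitW Wu.
have Du := unit_factor lm; have D0 := vunit_neq0 Du.
have th1u : th - i t1 \in vunit P.
  by rewrite (residue_unit (residueB thm (residueC P t1))) subr_eq0 eq_sym.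
(* Solves l0 (1 + l0^(q-1)) = (th - t1) (th - t0)^q + O(t^(q+1)) for [l0], the factor in l0^(q-1)
   being a unit. *)
pose E := ((th - i t1) * c ^+ q + t * r1) / (1 + l0 ^+ (3 * m)).
have Eu : E \in vunit P.
  rewrite rpred_div // vunitDm ?rpredM ?rpredX //.
  by rewrite maxidealMr.
have EO := vunitW Eu.
have l0E : l0 = t ^+ q * E.
  apply: (mulIf D0); rewrite /E mulrA divfK //.
  move/eqP: lE; rewrite subr_eq => /eqP lE.
  have -> : l0 * (1 + l0 ^+ (3 * m)) = l0 + l0 ^+ q by rewrite exprS; ring.
  by rewrite lE thE exprMn [t ^+ (3 * m).+2]exprS; ring.
split.
  exists (E * W + t * r2); first by apply: vunitDm; [apply: rpredM | apply: maxidealMr].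
  move/eqP: pE; rewrite subr_eq => /eqP ->; rewrite l0E [t ^+ (3 * m).+2]exprS; ring.
exists (i ((3%:R * A * B * (w ^+ 2 - w)) ^+ e.+1) * (c ^+ e * (th - i t1))
        + t ^+ (q - e) * (E * r + t * r3)).
  apply: vunitDm; first by rewrite !rpredM ?rpredX ?vunitC.
  apply: maxidealMr; first by apply: maxidealX; rewrite ?subn_gt0.
  by apply: rpredD; apply: rpredM.
move/eqP: fE; rewrite subr_eq => /eqP ->; rewrite l0E thE.
rewrite [(t * c) ^+ e]exprMn [t ^+ (3 * m).+2]exprS.
have tq : t ^+ q = t ^+ (q - e) * t ^+ e by rewrite -exprD subnK // ltnW.
rewrite -/q tq; ring.
Qed.

Lemma expansion_at_frobenius (P : place i) (s1 := A ^+ q) : u' != 0 -> v' != 0 -> t1 != 0 ->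
  x - i (s1 * t1) \in maxideal P -> y - i (t1 ^+ 3) \in maxideal P ->
  (exists2 U, U \in vunit P & pi = (y - i (t1 ^+ 3)) * U) /\ f0 \in maxideal P.
Proof.
move=> u0 v0 t1n0 xs yt; set t := y - _ in yt *; have tO := maxidealW yt.
have line1 : A + s1 = B * t1.
  by rewrite /s1 /t1 /A addrC -(exprDn_pchar _ _ char_q) herm0 exprMn.
(* Precision t^2 suffices here, where [l0] has a simple zero. *)
have [th [l0 [W [thm [c cu thE] lm Wu [[r2 r2O pE] [r1 r1O lE] [r rO [r3 r3O fE]]]]]]] :=
  local_expansion 0 line1 t1n0 u0 v0 xs yt.
rewrite -/t in thE pE lE fE.
have cO := vunitW cu; have WO := vunitW Wu.
have Du := unit_factor lm; have D0 := vunit_neq0 Du.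
have th0u : th - i t0 \in vunit P.
  by rewrite (residue_unit (residueB thm (residueC P t0))) subr_eq0.
pose E := (c * (th - i t0) ^+ q + t * r1) / (1 + l0 ^+ (3 * m)).
have Eu : E \in vunit P.
  rewrite rpred_div // vunitDm ?rpredM ?rpredX //.
  by rewrite maxidealMr.
have EO := vunitW Eu.
have l0E : l0 = t * E.
  apply: (mulIf D0); rewrite /E mulrA divfK //.
  move/eqP: lE; rewrite subr_eq => /eqP lE.
  have -> : l0 * (1 + l0 ^+ (3 * m)) = l0 + l0 ^+ q by rewrite exprS; ring.
  by rewrite lE thE; ring.
split.
  exists (E * W + t * r2); first by apply: vunitDm; [apply: rpredM | apply: maxidealMr].
  by move/eqP: pE; rewrite subr_eq => /eqP ->; rewrite l0E; ring.
move/eqP: fE; rewrite subr_eq => /eqP ->.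
have th1m : th - i t1 \in maxideal P by [].
apply: rpredD; first by rewrite maxidealMr // maxidealX.
apply: rpredD; last by rewrite maxidealMr.
by rewrite maxidealMl ?vringC // maxidealMl // rpredX // vunitW.
Qed.

End LocalExpansion.

(** * The node condition and the zeros of the tangent plane *)

(** The leading polar coefficient is a constant because the degree is one; subtracting its term
    lowers the pole order. *)
Lemma principal_part (k M : fieldType) (i : {rmorphism k -> M}) (P : place i) (pi : M) :
  uniformizer P pi -> degree_one P -> forall n g, g * pi ^+ n \in vring P ->
  exists2 c : {poly k}, (size c <= n.+1)%N & g - (map_poly i c).[pi^-1] \in vring P.
Proof.
move=> piP deg1; have pi0 := uniformizer_neq0 piP.
elim=> [|n IH] g gO.
  exists 0; rewrite ?size_poly0 // rmorph0 horner0 subr0.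
  by move: gO; rewrite expr0 mulr1.
have [r rm] := deg1 _ gO; have [h hO hE] := piP.2 _ rm.
have [|c cn cO] := IH (g - i r * pi^-1 ^+ n.+1).
  suff -> : (g - i r * pi^-1 ^+ n.+1) * pi ^+ n = h by [].
  apply: (mulfI pi0); rewrite -hE exprVn exprS; field.
  by rewrite pi0 expf_neq0.
exists (c + r *: 'X^(n.+1)).
  rewrite (leq_trans (size_polyD _ _)) // geq_max leqW //=.
  by rewrite (leq_trans (size_scale_leq _ _)) // size_polyXn.
rewrite rmorphD /= map_polyZ map_polyXn hornerD hornerZ hornerXn.
by rewrite [X in _ - X]addrC opprD addrA.
Qed.

Section HermitianParameters.
Variables (k : fieldType) (m : nat) (w s0 t0 : k).
Let q := (3 * m).+1.
Hypothesis char_q : [pchar k].-nat q.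
Hypotheses (w3 : w ^+ 3 = 1) (w1 : 1 + w + w ^+ 2 = 0) (k3 : 3%:R != 0 :> k).
Hypothesis herm0 : s0 ^+ q + s0 = t0 * t0 ^+ q.
Hypotheses (s00 : s0 != 0) (t00 : t0 != 0).
Let A := s0 ^+ q.
Let B := t0 ^+ q.
Let s1 := A ^+ q.
Let t1 := B ^+ q.

Lemma cube_root1_frobenius (c : k) : c ^+ 3 = 1 -> c ^+ q = c.
Proof. by move=> c3; rewrite /q exprS exprM c3 expr1n mulr1. Qed.

Lemma frobenius_herm : A + s1 = B * t1.
Proof. by rewrite /s1 /t1 /A addrC -(exprDn_pchar _ _ char_q) herm0 exprMn. Qed.

Lemma cube_root1_neq1 : 1 - w != 0.
Proof.
apply: contraNneq k3 => /eqP; rewrite subr_eq0 => /eqP w_1.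
by rewrite -w1 -w_1; apply/eqP; ring.
Qed.

Lemma conj1E s t : A + s = B * t -> conj1 w A B t = (1 - w) * (A - w * s).
Proof.
move=> st; have -> : conj1 w A B t = A * (1 - w ^+ 2) + (w ^+ 2 - w) * (B * t).
  by rewrite /conj1; ring.
by rewrite -st; ring.
Qed.

Lemma conj2E s t : A + s = B * t -> conj2 w A B t = (1 - w ^+ 2) * (A - w ^+ 2 * s).
Proof.
move=> st; have -> : conj2 w A B t = A * (1 - w) + (w - w ^+ 2) * (B * t).
  by rewrite /conj2; ring.
have w4 : w ^+ 4 = w by rewrite -[RHS]mul1r -w3; ring.
apply/eqP; rewrite -subr_eq0 -st; apply/eqP.
transitivity (s * (w - w ^+ 4)); first by ring.
by rewrite w4 subrr mulr0.
Qed.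

(** Since w^q = w, the q-th power of A - w^2 s0 is s1 - w^2 A = -w^2 (A - w s1): Frobenius
    interchanges the two conjugate lines. *)
Lemma conj1_frobenius : conj1 w A B t1 = - ((1 - w) * w * (A - w ^+ 2 * s0) ^+ q).
Proof.
rewrite (conj1E frobenius_herm) (exprDn_pchar _ _ char_q) (exprNn_pchar _ char_q) exprMn.
rewrite (@cube_root1_frobenius (w ^+ 2)); last by rewrite exprAC w3 expr1n.
rewrite -/A -/s1; apply/eqP; rewrite -subr_eq0; apply/eqP.
by transitivity ((1 - w) * A * (1 - w ^+ 3)); [ring | rewrite w3 subrr mulr0].
Qed.

Lemma conj2_frobenius : conj2 w A B t1 = - ((1 - w ^+ 2) * w ^+ 2 * (A - w * s0) ^+ q).
Proof.
rewrite (conj2E frobenius_herm) (exprDn_pchar _ _ char_q) (exprNn_pchar _ char_q) exprMn.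
rewrite (cube_root1_frobenius w3) -/A -/s1; apply/eqP; rewrite -subr_eq0; apply/eqP.
by transitivity ((1 - w ^+ 2) * A * (1 - w ^+ 3)); [ring | rewrite w3 subrr mulr0].
Qed.

(* Exactly the condition under which the form on the nodal cubic cut out by the
   tangent plane takes equal values on the two branches at the node. *)
Lemma node_condition j e E : (e.+1 = 3 * j)%N -> (q = E + e)%N ->
  (1 - w) * (A - w * s0) ^+ E + (1 - w ^+ 2) * (A - w ^+ 2 * s0) ^+ E = 0 ->
  conj2 w A B t0 ^+ e * conj2 w A B t1 = (- conj1 w A B t0) ^+ e * (- conj1 w A B t1).
Proof.
move=> ej qE; set mu := A - w * s0; set nu := A - w ^+ 2 * s0 => munu.
have line0 : A + s0 = B * t0 by rewrite /A herm0 mulrC.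
have n2 : 1 - w ^+ 2 = - (w ^+ 2) * (1 - w).
  apply/eqP; rewrite -subr_eq0; apply/eqP.
  by transitivity (1 - w ^+ 3); [ring | rewrite w3 subrr].
have muE : mu ^+ E = w ^+ 2 * nu ^+ E.
  apply: (mulfI cube_root1_neq1); move/eqP: munu; rewrite addr_eq0 => /eqP ->.
  by rewrite n2; ring.
rewrite conj1_frobenius conj2_frobenius (conj1E line0) (conj2E line0) -/mu -/nu.
have n2e : (1 - w ^+ 2) ^+ e.+1 = - ((-1) ^+ e * (1 - w) ^+ e.+1).
  rewrite n2 exprMn (exprNn (w ^+ 2)); have -> : (w ^+ 2) ^+ e.+1 = 1.
    by rewrite exprAC ej exprM w3 !expr1n.
  by rewrite exprS; ring.
have mq : mu ^+ q = w ^+ 2 * nu ^+ E * mu ^+ e by rewrite qE exprD muE.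
have nq : nu ^+ q = nu ^+ E * nu ^+ e by rewrite qE exprD.
rewrite mq nq opprK exprMn [(- _) ^+ e]exprNn [(_ * mu) ^+ e]exprMn.
transitivity (- ((1 - w ^+ 2) ^+ e.+1) * (w ^+ 3 * w * nu ^+ e * nu ^+ E * mu ^+ e)).
  by rewrite [(1 - w ^+ 2) ^+ e.+1]exprS; ring.
by rewrite n2e w3 [(1 - w) ^+ e.+1]exprS; ring.
Qed.

(** The q^2-Frobenius then maps (s0, t0) to its conjugate (c^2 s0, c t0), over the same values of x
    and y. In terms of alpha = 1 + A/s0 this is the value 1 + c = -c^2. *)
Lemma frobenius_fixed_conj (c : k) : c ^+ 3 = 1 -> 1 + c + c ^+ 2 = 0 -> A = c * s0 ->
  s1 * t1 = s0 * t0 /\ t1 ^+ 3 = t0 ^+ 3.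
Proof.
move=> c3 c1 Ac; have s1E : s1 = c ^+ 2 * s0.
  by rewrite /s1 {1}Ac exprMn (cube_root1_frobenius c3) -/A Ac; ring.
have B0 : B != 0 by rewrite expf_neq0.
have t1E : t1 = c * t0.
  apply: (mulfI B0); rewrite -frobenius_herm s1E Ac mulrCA [B * t0]mulrC /B -herm0 -/A Ac.
  apply/eqP; rewrite -subr_eq0; apply/eqP; ring.
by rewrite t1E s1E exprMn c3 mul1r; split=> //; rewrite -[RHS]mul1r -c3; ring.
Qed.

Lemma frobenius_fixed : t1 = t0 -> s1 * t1 = s0 * t0 /\ t1 ^+ 3 = t0 ^+ 3.
Proof.
move=> tE; rewrite tE; split=> //; congr (_ * _).
apply: (addrI A); rewrite frobenius_herm tE /A herm0 mulrC //.
Qed.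

Section NotFixed.
Hypothesis nfix : ~ (s1 * t1 = s0 * t0 /\ t1 ^+ 3 = t0 ^+ 3).

Let w2_3 : (w ^+ 2) ^+ 3 = 1. Proof. by rewrite exprAC w3 expr1n. Qed.
Let w2_1 : 1 + w ^+ 2 + (w ^+ 2) ^+ 2 = 0.
Proof.
have -> : (w ^+ 2) ^+ 2 = w by rewrite -[RHS]mul1r -w3; ring.
by rewrite -w1; ring.
Qed.

Let mu0 : A - w * s0 != 0.
Proof. by rewrite subr_eq0; apply/eqP => /(frobenius_fixed_conj w3 w1). Qed.

Let nu0 : A - w ^+ 2 * s0 != 0.
Proof. by rewrite subr_eq0; apply/eqP => /(frobenius_fixed_conj w2_3 w2_1). Qed.

Let w0 : w != 0.
Proof. by apply: contra_eq_neq w3 => ->; rewrite expr0n eq_sym oner_eq0. Qed.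

Let w20 : 1 - w ^+ 2 != 0.
Proof.
have -> : 1 - w ^+ 2 = (1 - w) * (1 + w) by ring.
rewrite mulf_neq0 ?cube_root1_neq1 //.
have -> : 1 + w = - w ^+ 2 by apply/eqP; rewrite -addr_eq0 w1.
by rewrite oppr_eq0 expf_neq0.
Qed.

(** A conjugate line through one of the two points, or equality of t0 and t1, would make the values
    of x and y Frobenius-fixed. *)
Lemma conj_neq0 : [/\ conj1 w A B t0 != 0, conj2 w A B t0 != 0,
  conj1 w A B t1 != 0, conj2 w A B t1 != 0 & [/\ t1 != t0, t1 != 0 & w ^+ 2 - w != 0]].
Proof.
have line0 : A + s0 = B * t0 by rewrite /A herm0 mulrC.
have w1' := cube_root1_neq1.
split.
- by rewrite (conj1E line0) mulf_neq0.
- by rewrite (conj2E line0) mulf_neq0.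
- by rewrite conj1_frobenius oppr_eq0 !mulf_neq0 ?expf_neq0.
- by rewrite conj2_frobenius oppr_eq0 !mulf_neq0 ?expf_neq0.
- split; first by apply/eqP => /frobenius_fixed.
    by rewrite !expf_neq0.
  have -> : w ^+ 2 - w = - w * (1 - w) by ring.
  by rewrite mulf_neq0 ?oppr_eq0.
Qed.

End NotFixed.
End HermitianParameters.

(** * Hermitian points over the places of [L] *)

Lemma cube_root_exists (K : closedFieldType) (b : K) : exists t, t ^+ 3 = b.
Proof.
have /closed_rootP[t] : size ('X^3 - b%:P) != 1%N by rewrite size_XnsubC.
by rewrite /root !hornerE subr_eq0 => /eqP; exists t.
Qed.

Section Centers.
Variables (K : closedFieldType) (L : fieldType) (i : {rmorphism K -> L}).
Variables (m : nat) (x y z : L).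
Let q := (3 * m).+1.
Hypothesis m0 : (0 < m)%N.
Hypothesis xyz : Y3_triple m x y z.
Hypothesis gen : field_generated (coord_gens i x y).

(** Where y does not vanish, t is a cube root of its value and s = x/t. Where it vanishes so does x;
    then t = 0, s has to come from z, and [Y3_norm_y] supplies the Hermitian equation. *)
Lemma affine_center (R : place i) : z \in vring R -> exists s t : K,
  [/\ x - i (s * t) \in maxideal R, y - i (t ^+ 3) \in maxideal R,
      z - i (s ^+ 3) \in maxideal R & s ^+ q + s = t * t ^+ q].
Proof.
move=> zO; have [xO yO] := Y3_vring xyz zO; have [_ _ z0 zy _] := xyz.
have zm1 := Y3_neq0 xyz.
have gen_yz : field_generated (coord_gens i y z).
  have yA := field_closure_l i y z; have zA := field_closure_r i y z.
  apply: (field_generated_coord gen) => //.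
  by rewrite (Y3_x xyz zm1) rpred_div ?rpredX ?rpredD ?rpredX ?rpred1.
have [b yb] := residue_exists (Y3_integral_xy xyz i m0) gen xO yO.
have [a xa] := residue_exists (Y3_integral_yx xyz i m0) (Y3_gen_yx gen) yO xO.
have [c zc] := residue_exists (Y3_integral_yz xyz i) gen_yz yO zO.
have cb : c * b = a ^+ 3.
  by apply: (@residue_uniq _ _ i R (x ^+ 3)); [rewrite -zy; apply: residueM | apply: residueX].
have [b0|b0] := eqVneq b 0; last first.
  have [t tb] := cube_root_exists b.
  have t0 : t != 0 by apply: contraNneq b0 => t0; rewrite -tb t0 expr0n.
  exists (a / t), t; rewrite divfK // tb; split=> //.
    by rewrite expr_div_n tb -cb mulfK.
  have E := Y3_center xyz xa yb.
  apply: (mulfI (expf_neq0 q t0)); rewrite mulrDr -exprMn [t * (a / t)]mulrC divfK //.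
  have -> : t ^+ q * (a / t) = a * b ^+ m.
    by rewrite -tb -exprM /q exprS; field.
  have qm : (3 * (2 * m).+1 = q + q.+1)%N by rewrite /q; lia.
  by rewrite E -tb -exprM -exprS -exprD qm.
have a0 : a = 0.
  by move/esym/eqP: cb; rewrite b0 mulr0 expf_eq0 => /andP[_ /eqP].
have [s sc] := cube_root_exists c; exists s, 0.
split; [by rewrite mulr0 -a0 | by rewrite (_ : 0 ^+ 3 = b) // b0 expr0n | by rewrite sc |].
rewrite mul0r.
have : (c * (c ^+ m + 1) ^+ 3) = 0.
  have nc : z * (z ^+ m + 1) ^+ 3 - i (c * (c ^+ m + 1) ^+ 3) \in maxideal R.
    apply: residueM => //; apply/residueX/residueD; first exact: residueX.
    by rewrite rmorph1 subrr maxideal0.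
  by apply/eqP; rewrite -(residue_max nc) (Y3_norm_y xyz) maxidealX // (residue_max yb) b0.
rewrite -sc -exprMn => /eqP; rewrite expf_eq0 /= => /eqP E.
by rewrite -[RHS]E -exprM /q exprS; ring.
Qed.

Section TangentPlane.
Variables (w s0 t0 : K).
Hypothesis char_q : [pchar K].-nat q.
Hypotheses (w3 : w ^+ 3 = 1) (w1 : 1 + w + w ^+ 2 = 0).
Hypothesis herm0 : s0 ^+ q + s0 = t0 * t0 ^+ q.
Let A := s0 ^+ q.
Let B := t0 ^+ q.
Let s1 := A ^+ q.
Let t1 := B ^+ q.

(* On the Hermitian curve the tangent at [(s0, t0)] restricts to
   [(t - t1) (t - t0)^q]. *)
Lemma tangent_plane_center (R : place i) : z \in vring R ->
  tangent_plane i x y z A B \in maxideal R ->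
  (x - i (s0 * t0) \in maxideal R /\ y - i (t0 ^+ 3) \in maxideal R) \/
  (x - i (s1 * t1) \in maxideal R /\ y - i (t1 ^+ 3) \in maxideal R).
Proof.
move=> /affine_center[s [t [xs yt zs herm]]] pim.
have tan_norm : tangent A B 1 t s * (tangent A B w t s * tangent A B (w ^+ 2) t s) = 0.
  rewrite (tangent_norm _ _ w3 w1); apply/eqP.
  rewrite -(residue_max (z := tangent_plane i x y z A B) (P := R)) //.
  rewrite /tangent_plane; apply: residueD; last first.
    by apply: residueM => //; apply: residueC.
  apply: residueB; first by apply: residueD => //; apply: residueC.
  by apply: residueM => //; apply: residueC.
have [c [c3 ct]] : exists c, c ^+ 3 = 1 /\ tangent A B c t s = 0.
  move/eqP: tan_norm; rewrite !mulf_eq0 => /or3P[] /eqP E.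
  - by exists 1; rewrite expr1n.
  - by exists w.
  - by exists (w ^+ 2); rewrite exprAC w3 expr1n.
(* The deck transformation moves the point onto the tangent line itself without changing x and y. *)
pose s' := c ^+ 2 * s; pose t' := c * t.
have xs' : x - i (s' * t') \in maxideal R.
  by rewrite (_ : s' * t' = s * t) // -[RHS]mul1r -c3 /s' /t'; ring.
have yt' : y - i (t' ^+ 3) \in maxideal R by rewrite exprMn c3 mul1r.
have cq : c ^+ q = c by apply: cube_root1_frobenius.
have herm' : s' ^+ q + s' = t' * t' ^+ q.
  have -> : s' ^+ q = c ^+ 2 * s ^+ q by rewrite exprMn exprAC cq.
  have -> : t' ^+ q = c * t ^+ q by rewrite exprMn cq.
  by rewrite -mulrDr herm /t'; ring.
have sE : s' = B * t' - A.
  by apply/eqP; rewrite -subr_eq0 -ct /tangent /s' /t'; apply/eqP; ring.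
have AB := frobenius_herm char_q herm0; rewrite -/A -/B -/s1 -/t1 in AB.
have : (t' - t1) * (t' - t0) ^+ q = 0.
  rewrite (exprDn_pchar _ _ char_q) (exprNn_pchar _ char_q) -/B.
  have -> : (t' - t1) * (t' ^+ q - B)
    = t' * t' ^+ q - (B * t' - A) - (t1 * t' ^+ q - s1) + (B * t1 - A - s1) by ring.
  rewrite -AB -herm'.
  have -> : s' ^+ q = t1 * t' ^+ q - s1.
    by rewrite sE (exprDn_pchar _ _ char_q) (exprNn_pchar _ char_q) exprMn.
  by rewrite sE; ring.
move/eqP; rewrite mulf_eq0 expf_eq0 !subr_eq0 /= => /orP[] /eqP tE; [right|left].
  have -> : s1 = s' by rewrite sE tE -AB; ring.
  by rewrite -tE.
have -> : s0 = s' by rewrite sE tE [B * _]mulrC /B -herm0 /A; ring.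
by rewrite -tE.
Qed.

End TangentPlane.
End Centers.

(** * The nongap *)

Lemma pchar_nat_eq0 (R : nzRingType) n : (1 < n)%N -> [pchar R].-nat n -> n%:R = 0 :> R.
Proof.
move=> n1 Rn; have pn := pdiv_dvd n.
have pR : pdiv n \in [pchar R] by move/(pnatP _ (ltnW n1)): Rn; apply; rewrite ?pdiv_prime.
by have /dvdnP[l ->] := pn; rewrite natrM (pcharf0 pR) mulr0.
Qed.

Lemma horner_inv_vring (k M : fieldType) (i : {rmorphism k -> M}) (P : place i)
    (c : {poly k}) (pi : M) n : (size c <= n.+1)%N -> pi != 0 -> pi \in vring P ->
  (map_poly i c).[pi^-1] * pi ^+ n \in vring P.
Proof.
move=> cn pi0 piO; rewrite (horner_coef_wide _ (n := n.+1)) ?size_map_poly // mulr_suml.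
apply: rpred_sum => l _; rewrite coef_map /=.
have ln : (l <= n)%N by rewrite -ltnS.
have -> : i c`_l * pi^-1 ^+ l * pi ^+ n = i c`_l * pi ^+ (n - l).
  have -> : pi ^+ n = pi ^+ l * pi ^+ (n - l) by rewrite -exprD subnKC.
  by rewrite exprVn; field; rewrite expf_neq0.
by rewrite rpredM ?rpredX ?vringC.
Qed.

Lemma horner_vring (k M : fieldType) (i : {rmorphism k -> M}) (P : place i)
    (c : {poly k}) (a : M) : a \in vring P -> (map_poly i c).[a] \in vring P.
Proof.
by move=> aO; rewrite horner_poly rpred_sum // => l _; rewrite rpredM ?rpredX ?vringC.
Qed.

Section Nongap.
Variables (K : closedFieldType) (L : fieldType) (i : {rmorphism K -> L}).
Variables (m : nat) (x y z : L) (w s0 t0 : K) (j e : nat).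
Let q := (3 * m).+1.
Hypothesis m0 : (0 < m)%N.
Hypothesis xyz : Y3_triple m x y z.
Hypothesis gen : field_generated (coord_gens i x y).
Hypothesis char_q : [pchar K].-nat q.
Hypotheses (w3 : w ^+ 3 = 1) (w1 : 1 + w + w ^+ 2 = 0) (k3 : 3%:R != 0 :> K).
Hypothesis herm0 : s0 ^+ q + s0 = t0 * t0 ^+ q.
Hypotheses (s00 : s0 != 0) (t00 : t0 != 0).
Let A := s0 ^+ q.
Let B := t0 ^+ q.
Let s1 := A ^+ q.
Let t1 := B ^+ q.
Hypothesis nfix : ~ (s1 * t1 = s0 * t0 /\ t1 ^+ 3 = t0 ^+ 3).
Hypothesis node : conj2 w A B t0 ^+ e * conj2 w A B t1
  = (- conj1 w A B t0) ^+ e * (- conj1 w A B t1).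
Hypotheses (ej : (e.+1 = 3 * j)%N) (eltq : (e < q)%N).

Variable P : place i.
Hypotheses (xP : x - i (s0 * t0) \in maxideal P) (yP : y - i (t0 ^+ 3) \in maxideal P).

Let pi := tangent_plane i x y z A B.
Let f0 := contact_form i x y w A B t0 t1 e.

Let char_q0 : q%:R = 0 :> K.
Proof. by apply: pchar_nat_eq0; rewrite // ltnS muln_gt0. Qed.

Lemma Y3_place_of_center (Q R : place i) s t : t != 0 ->
  x - i (s * t) \in maxideal Q -> y - i (t ^+ 3) \in maxideal Q ->
  x - i (s * t) \in maxideal R -> y - i (t ^+ 3) \in maxideal R -> Q = R.
Proof.
move=> t_neq0 xQ yQ xR yR.
have [D [G [DR GR DG Du]]] := Y3_chart xyz char_q0 xQ yQ (expf_neq0 3 t_neq0).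
exact: (place_of_center (Y3_integral_xy xyz i m0) gen xQ yQ xR yR DR GR DG Du).
Qed.

Lemma Y3_uniformizer (R : place i) s t : t != 0 ->
  x - i (s * t) \in maxideal R -> y - i (t ^+ 3) \in maxideal R ->
  uniformizer R (y - i (t ^+ 3)) /\ degree_one R.
Proof.
move=> t_neq0 xR yR; have xy_int := Y3_integral_xy xyz i m0.
have [D [G [DR GR DG Du]]] := Y3_chart xyz char_q0 xR yR (expf_neq0 3 t_neq0).
split; first exact: (local_uniformizer xy_int gen xR yR DR GR DG Du).
exact: (local_degree_one xy_int gen xR yR DR GR DG Du).
Qed.

(** Among 1, x, y, z the pole of z dominates, so [pi] behaves like z. Each line behaves at worst
    like z^(1/3), and [f0] has degree e + 1 = 3j in the lines. *)
Lemma contact_regular_infinity (R : place i) : z \notin vring R ->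
  f0 / pi ^+ j \in vring R /\ pi^-1 \in vring R.
Proof.
move=> zO; have [_ _ z0 _ _] := xyz; have zVm := maxidealV zO.
have [Xm Ym] := Y3_maxideal (Y3_dual xyz) zVm.
have zVO := maxidealW zVm.
have piz : pi / z \in vunit R.
  have -> : pi / z
    = 1 + (i (A ^+ 3) * z^-1 - i (B ^+ 3) * (y / z) + i (3%:R * (A * B)) * (x / z)).
    by rewrite /pi /tangent_plane; field.
  rewrite vunitDm ?rpred1 // rpredD ?rpredB //; by rewrite maxidealMl ?vringC.
have zpi : z / pi \in vring R by rewrite -invf_div vunitW // rpredV.
have pi0 : pi != 0.
  by apply: contraNneq (vunit_neq0 piz) => ->; rewrite mul0r.
split; last first.
  have -> : pi^-1 = z^-1 * (z / pi) by rewrite mulKf.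
  exact: rpredM.
have f0z : f0 / z ^+ j \in vring R.
  apply: (@vring_expI _ _ _ R _ 3) => //.
  have := @contact_form_integral _ _ i _ _ _ _ w A B t0 t1 e xyz R z^-1 zVO (maxidealW Ym).
  rewrite mulfV // => /(_ (rpred1 _)); rewrite ej -/f0.
  rewrite (_ : (f0 / z ^+ j) ^+ 3 = f0 ^+ 3 * z^-1 ^+ (3 * j)) //.
  by rewrite expr_div_n -exprM mulnC exprVn.
have -> : f0 / pi ^+ j = f0 / z ^+ j * (z / pi) ^+ j.
  by rewrite expr_div_n mulrA divfK ?expf_neq0.
by apply: rpredM => //; apply: rpredX.
Qed.

Lemma contact_regular_affine (R : place i) : z \in vring R -> f0 \in vring R /\ pi \in vring R.
Proof.
move=> zO; have [xO yO] := Y3_vring xyz zO; split.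
  apply: (@vring_expI _ _ _ R _ 3) => //.
  have := @contact_form_integral _ _ i _ _ _ _ w A B t0 t1 e xyz R 1 (rpred1 _).
  by rewrite !mulr1 expr1n mulr1; apply.
by rewrite /pi /tangent_plane rpredD ?rpredB ?rpredD ?rpredM ?vringC.
Qed.

Lemma contact_nongap : nongaps P (j * q - e)%N.
Proof.
have j0 : (0 < j)%N by move: ej; case: (j).
have [u0 v0 u'0 v'0 [t10 t1n0 ww0]] := conj_neq0 char_q w3 w1 k3 herm0 t00 nfix.
have [[U Uu piE] [V Vu f0E]] :=
  expansion_at_point m0 xyz w3 w1 char_q k3 herm0 s00 t00 node ww0 t10 u0 v0 eltq xP yP.
have [tP _] := Y3_uniformizer t00 xP yP.
have t_neq0 := uniformizer_neq0 tP.
rewrite -/pi -/A -/B in piE; rewrite -/f0 in f0E.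
set t := y - i (t0 ^+ 3) in piE f0E tP t_neq0.
have pi0 : pi != 0 by rewrite piE mulf_neq0 ?expf_neq0 // (vunit_neq0 Uu).
have [c cj cQ] : exists2 c : {poly K}, (size c <= j)%N &
    forall R : place i, x - i (s1 * t1) \in maxideal R -> y - i (t1 ^+ 3) \in maxideal R ->
    f0 / pi ^+ j - (map_poly i c).[pi^-1] \in vring R.
  (* No place over the Frobenius image has to be exhibited: if there is none, there is no pole to
     cancel. *)
  have [[Q [xQ yQ]]|noQ] := pselect (exists Q : place i,
    x - i (s1 * t1) \in maxideal Q /\ y - i (t1 ^+ 3) \in maxideal Q); last first.
    by exists 0; rewrite ?size_poly0 // => R xR yR; case: noQ; exists R.
  have [[U' U'u piE'] f0m] :=
    expansion_at_frobenius m0 xyz w3 w1 char_q k3 herm0 node t10 u'0 v'0 t1n0 xQ yQ.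
  have {}piE' : pi = (y - i (t1 ^+ 3)) * U' by exact: piE'.
  have [tQ deg1Q] := Y3_uniformizer t1n0 xQ yQ.
  have piQ : uniformizer Q pi.
    split; first by rewrite piE' maxidealMr ?(vunitW U'u).
    move=> h hm; have [r rO ->] := tQ.2 _ hm; exists (r / U').
      by rewrite rpredM // vunitW // rpredV.
    by rewrite piE'; field; apply: vunit_neq0 U'u.
  have [g gO gE] := piQ.2 _ f0m.
  (* The zero of [f0] at [Q] lowers the pole order there from j to j - 1, which gives the bound on
     [c]. *)
  have [|c cj cO] := principal_part piQ deg1Q (n := j.-1) (g := f0 / pi ^+ j).
    rewrite (_ : f0 = pi * g) // -[in X in _ / X](prednK j0) exprS.
    by rewrite (_ : _ * _ = g) //; field; rewrite pi0 expf_neq0.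
  exists c; first by rewrite -(prednK j0).
  by move=> R xR yR; rewrite -(Y3_place_of_center t1n0 xQ yQ xR yR).
pose f := f0 / pi ^+ j - (map_poly i c).[pi^-1].
have eqj : (e < j * q)%N by apply: leq_trans eltq _; rewrite leq_pmull.
have tm : t \in maxideal P := yP.
(* The correction has a pole of order at most (j - 1) q at P, smaller than j q - e because e < q, so
   the leading term is that of f0 / pi^j. *)
have [F Fu fE] : exists2 F, F \in vunit P & f = F * t ^ (- (j * q - e)%N%:Z).
  exists (f * t ^+ (j * q - e)); last first.
    by rewrite -exprnN -mulrA mulfV ?mulr1 // expf_neq0.
  rewrite /f mulrBl.
  have -> : f0 / pi ^+ j * t ^+ (j * q - e) = V / U ^+ j.
    have E : t ^+ e * t ^+ (j * q - e) = (t ^+ q) ^+ j.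
      by rewrite -exprD subnKC 1?ltnW // -exprM mulnC.
    rewrite f0E piE exprMn -E; field.
    by rewrite !expf_neq0 // (vunit_neq0 Uu).
  apply: vunitDm; first by rewrite rpred_div // rpredX.
  rewrite rpredN.
  have piO : pi \in vring P by rewrite piE; apply: rpredM; [apply/rpredX/maxidealW | apply: vunitW].
  have cj' : (size c <= j.-1.+1)%N by rewrite prednK.
  have -> : t ^+ (j * q - e) = pi ^+ j.-1 * (t ^+ (q - e) / U ^+ j.-1).
    have -> : (j * q - e = q * j.-1 + (q - e))%N.
      by rewrite -{1}(prednK j0) mulSn addnC [(q * _)%N]mulnC addnBA // ltnW.
    rewrite exprD exprM piE exprMn; field.
    by rewrite expf_neq0 // (vunit_neq0 Uu).
  rewrite (mulrA (map_poly i c).[pi^-1]); apply: maxidealMl; first exact: horner_inv_vring.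
  by apply: maxidealMr; [rewrite maxidealX ?subn_gt0 | rewrite vunitW // rpredV rpredX].
have Pval : pole_divisor f P = (j * q - e)%N%:Z.
  rewrite /pole_divisor (valuationE tP Fu fE) opprK oppr_lt0.
  by rewrite ltz_nat subn_gt0 eqj.
exists f; split.
  by rewrite fE mulf_neq0 ?expfz_neq0 // (vunit_neq0 Fu).
move=> R; rewrite /point_divisor; case: asboolP => [->//|RP].
apply: pole_divisor_vring.
have [zO|zO] := boolP (z \in vring R); last first.
  have [f0O piVO] := contact_regular_infinity zO.
  by rewrite rpredB // horner_vring.
have [f0O piO] := contact_regular_affine zO.
case: (vring_dec piO) => [piu|pim].
  have piVO : pi^-1 \in vring R by rewrite vunitW // rpredV.
  by rewrite rpredB ?horner_vring // -exprVn rpredM ?rpredX.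
have [[xR yR]|[xR yR]] := tangent_plane_center m0 xyz gen char_q w3 w1 herm0 zO pim.
  by case: RP; apply: Y3_place_of_center t00 xR yR xP yP.
exact: cQ.
Qed.

End Nongap.

(** * Finite constants, the Q-order and the conclusion *)

Lemma finField_fixed (F : finFieldType) (K : fieldType) (i : {rmorphism F -> K}) (c : K) :
  c ^+ #|F| = c -> exists d, c = i d.
Proof.
move=> cF; have : (map_poly i ('X^#|F| - 'X)).[c] = 0.
  by rewrite rmorphB /= map_polyXn map_polyX !hornerE cF subrr.
rewrite finField_genPoly rmorph_prod horner_prod => /eqP/prodf_eq0[d _].
by rewrite rmorphB /= map_polyX map_polyC /= !hornerE subr_eq0 => /eqP; exists d.
Qed.

Lemma prim_root3_sum (K : fieldType) (w : K) : 3.-primitive_root w -> 1 + w + w ^+ 2 = 0.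
Proof.
move=> w3; have wn1 : w - 1 != 0.
  rewrite subr_eq0; apply/eqP => w1.
  by have := prim_order_dvd w3 1; rewrite w1 expr1n eqxx.
apply: (mulfI wn1); rewrite mulr0.
by transitivity (w ^+ 3 - 1); [ring | rewrite (prim_expr_order w3) subrr].
Qed.

Lemma Qpoly_root (K : fieldType) (w S : K) (n : nat) : 3.-primitive_root w ->
  3%:R != 0 :> K -> (0 < n)%N -> root (Qpoly w n) S ->
  (1 - w) * (S + w) ^+ (3 * n - 1) + (1 - w ^+ 2) * (S + w ^+ 2) ^+ (3 * n - 1) = 0.
Proof.
move=> w3 k3 n0 /rootP QS.
have : (Qnum w n).[S] = 0 by rewrite -(divpK (Qnum_dvd w3 n0)) hornerM QS mul0r.
rewrite /Qnum !hornerE => /(congr1 ( *%R^~ 3%:R)); rewrite mul0r => <-.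
by field.
Qed.

Lemma order_le_root (K : fieldType) (w S : K) n : order_le (Qorder_at w S) n ->
  exists2 k, (0 < k <= n)%N & root (Qpoly w k.+1) S.
Proof.
case=> k; rewrite /Qorder_at; case: pselect => // ex [<-].
case: ex_minnP => l /andP[l0 lS] _ ln.
by exists l; rewrite ?l0.
Qed.

(** The number equals (j - 1) q + (q - 2 - 3 (j - 1)), the last element of the row of index j -
    1. *)
Lemma contact_in_Ggen (m j : nat) : (0 < j < m)%N ->
  Ggen (3 * m).+1 (j * (3 * m).+1 - (3 * j - 1))%N.
Proof.
move=> /andP[j0 jm]; exists j.-1, ((3 * m).+1 - (3 * j - 1))%N.
have q3 : (((3 * m).+1 - 1) %/ 3 = m)%N by rewrite subn1 mulKn.
rewrite q3; split; [lia | lia |].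
by case: j j0 jm => // j _ jm; rewrite mulSn /= addnC addnBA; lia.
Qed.

Lemma prime_power_1mod3 p n q : prime p -> (0 < n)%N -> q = (p ^ n)%N -> q = 1 %[mod 3] ->
  exists2 m, (0 < m)%N & q = (3 * m).+1.
Proof.
move=> pp n0 qE q3; have q1 : (1 < q)%N by rewrite qE -(exp1n n) ltn_exp2r // prime_gt1.
exists (q %/ 3)%N; first by lia.
by rewrite {1}(divn_eq q 3) q3 addn1 mulnC.
Qed.

Lemma pchar_nat_finField p n q (F : finFieldType) : prime p -> q = (p ^ n)%N ->
  #|F| = (q ^ 2)%N -> [pchar F].-nat q.
Proof.
move=> pp qE Fq; have pF : p \in [pchar F].
  by apply: (@card_finPcharP _ _ (n * 2)); rewrite // Fq qE expnM.
by rewrite qE pnatX pnatE // pF.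
Qed.

Lemma constant_extension_gen (F K Y L : fieldType) (iFK : {rmorphism F -> K})
    (iFY : {rmorphism F -> Y}) (iKL : {rmorphism K -> L}) (iYL : {rmorphism Y -> L}) (x y : Y) :
  is_constant_field_extension iFK iFY iKL iYL -> field_generated (coord_gens iFY x y) ->
  field_generated (coord_gens iKL (iYL x) (iYL y)).
Proof.
move=> [compat genL] genY; apply: field_closure_full => z.
set C := field_closure _.
have CY w : iYL w \in C.
  pose D : {pred Y} := [pred w | iYL w \in C].
  have DE v : (v \in D) = (iYL v \in C) by [].
  rewrite -DE; apply: (genY D) => [|s [[c ->]|[->|->]]].
  - split=> [|a b|a b]; rewrite !DE ?rmorph1 ?rpred1 // => aC bC.
    + by rewrite rmorphB rpredB.
    + by rewrite fmorph_div rpred_div.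
  - by rewrite DE -compat; apply: field_closure_gen; left; exists (iFK c).
  - by rewrite DE field_closure_l.
  - by rewrite DE field_closure_r.
apply: genL z => [|s [[c ->]|[w ->]]] //; first exact: field_closure_divring.
by apply: field_closure_gen; left; exists c.
Qed.

(** k >= 1 keeps j below m, and k <= m - 1 keeps it positive. The third equality identifies the
    exponent of Q_(k+1) with the exponent E of [node_condition]. *)
Lemma contact_indices (m k : nat) (j := (m - k)%N) (e := (3 * j - 1)%N) :
  (0 < k <= m - 1)%N ->
  [/\ (0 < j < m)%N, (e.+1 = 3 * j)%N, ((3 * m).+1 = 3 * k.+1 - 1 + e)%N & (e < (3 * m).+1)%N].
Proof. by move=> /andP[k0 km]; rewrite /e /j; split; lia. Qed.

Theorem corollary6p11
  (p n q : nat) (hp : prime p) (hn : (0 < n)%N) (hq : q = (p ^ n)%N)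
  (hq3 : q = 1 %[mod 3])
  (F : finFieldType) (hF : #|F| = (q ^ 2)%N)
  (K : closedFieldType) (iFK : {rmorphism F -> K})
  (hK : is_algebraic_closure iFK)
  (Y : fieldType) (iFY : {rmorphism F -> Y}) (x y : Y)
  (hY : is_function_field_Y3 q iFY x y)
  (L : fieldType) (iKL : {rmorphism K -> L}) (iYL : {rmorphism Y -> L})
  (hL : is_constant_field_extension iFK iFY iKL iYL)
  (zeta3 : K) (hzeta3 : 3.-primitive_root zeta3)
  (P : place iKL)
  (hP : ~ rational_place iFY iYL P)
  (hord : order_le (Qorder zeta3 q (iYL x) (iYL y) P) ((q - 1) %/ 3 - 1)) :
  gaps P <> Ggen q.
Proof.
have [m m0 qm] := prime_power_1mod3 hp hn hq hq3.
have F_q := pchar_nat_finField hp hq hF.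
have q3 : ((q - 1) %/ 3 = m)%N by rewrite qm subn1 mulKn.
have q23 : ((2 * q + 1) %/ 3 = (2 * m).+1)%N by rewrite qm; lia.
have q23' : ((q + 2) %/ 3 = m.+1)%N by rewrite qm; lia.
rewrite /Qorder /alpha q3 q23' in hord.
case: hY; rewrite q3 q23 => curve xtr genY.
move: hq hF F_q curve; rewrite {}qm => {hq3 q3 q23 q23'} hq hF F_q curve.
have [k km kroot] := order_le_root hord.
have compat := hL.1.
have char_q := pnat_pchar_fmorph iFK F_q.
have q1 : (1 < (3 * m).+1)%N by rewrite ltnS muln_gt0.
have F_q0 := pchar_nat_eq0 q1 F_q; have K_q0 := pchar_nat_eq0 q1 char_q.
have k3 : 3%:R != 0 :> K.
  apply: contra_eq_neq K_q0 => k3; by rewrite -addn1 natrD natrM k3 mul0r add0r oner_eq0.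
have x0 : x != 0 by apply/eqP => x0; apply: xtr; rewrite x0; apply: algebraic0.
have y0 : y != 0.
  apply: contraNneq x0 => y0; move/eqP: curve.
  by rewrite y0 !expr0n (gtn_eqF m0) mulr0 addr0 subr0 expf_eq0.
have tY := Y3_triple_of_curve x0 y0 curve; set z := x ^+ 3 / y in tY.
have tL := Y3_triple_map iYL tY.
have genL := constant_extension_gen hL genY.
have w3 := prim_expr_order hzeta3; have w1 := prim_root3_sum hzeta3.
(* A pole of z is the place at infinity, which is rational. *)
have zO : iYL z \in vring P.
  by apply/negPn/negP => zO; apply/hP/(rational_infinity compat m0 tY genY zO).
have [s0 [t0 [xP yP zP herm0]]] := affine_center m0 tL genL zO.
have frob_fixed (c : K) : c ^+ (3 * m).+1 ^+ (3 * m).+1 = c -> exists d, c = iFK d.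
  by move=> cq; apply: finField_fixed; rewrite hF expnS expn1 exprM.
(* If t0 = 0, then either s0 = 0 and P is the origin, or s0^(q-1) = -1. In the latter case the
   q-Frobenius changes the sign of s0^3, so its square fixes s0^3, the value of z lies in [F] and P
   is again rational. *)
have t00 : t0 != 0.
  apply/eqP => t00; move/eqP: herm0; rewrite t00 mul0r exprS -[X in _ + X]mulr1 -mulrDr.
  rewrite mulf_eq0 => /orP[/eqP s00|].
    apply/hP/(rational_origin compat m0 tY genY).
    by rewrite (residue_max zP) s00 expr0n.
  rewrite addr_eq0 => /eqP sm.
  have cm : (s0 ^+ 3) ^+ m = -1 by rewrite -exprM.
  have cq : (s0 ^+ 3) ^+ (3 * m).+1 = - s0 ^+ 3.
    by rewrite exprS mulnC exprM cm; ring.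
  have [d dE] : exists d, s0 ^+ 3 = iFK d.
    by apply: frob_fixed; rewrite cq (exprNn_pchar _ char_q) cq opprK.
  apply/hP/(rational_node compat m0 F_q0 tY genY (c := d)); last by rewrite -dE.
  by apply: (fmorph_inj iFK); rewrite rmorphXn -dE cm rmorphN1.
have s00 : s0 != 0.
  apply/eqP => s00; move/esym/eqP: herm0.
  by rewrite s00 expr0n addr0 -exprS expf_eq0 (negPf t00) andbF.
set A := s0 ^+ (3 * m).+1 in herm0; set B := t0 ^+ (3 * m).+1 in herm0.
(* Values of x and y fixed by the q^2-Frobenius lie in [F]; as y does not vanish at P, this makes P
   rational. *)
have nfix : ~ (A ^+ (3 * m).+1 * B ^+ (3 * m).+1 = s0 * t0
    /\ (B ^+ (3 * m).+1) ^+ 3 = t0 ^+ 3).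
  case=> afix bfix.
  have [a aE] : exists a, s0 * t0 = iFK a by apply: frob_fixed; rewrite !exprMn.
  have [b bE] : exists b, t0 ^+ 3 = iFK b.
    by apply: frob_fixed; rewrite [(t0 ^+ 3) ^+ _]exprAC exprAC.
  apply/hP/(rational_affine compat m0 F_q0 tY genY xtr (a := a) (b := b)).
  - by rewrite -(fmorph_eq0 iFK) -bE expf_neq0.
  - by rewrite -aE.
  - by rewrite -bE.
have root := Qpoly_root hzeta3 k3 (ltn0Sn k) kroot.
(* alpha(P) = t0^(q+1) / s0 = (s0^q + s0) / s0 by the Hermitian equation. *)
have SE : 1 - residue P (iYL y) ^+ m.+1 / residue P (iYL x) = - (A / s0).
  rewrite (residueE xP) (residueE yP) -exprM mulnS.
  have -> : A = t0 * B - s0 by rewrite -herm0 addrK.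
  have -> : t0 ^+ (3 + 3 * m) = t0 ^+ 2 * B by rewrite /B -exprD addnS.
  by field; rewrite s00 t00.
rewrite {}SE in root.
have [jm ej qE eltq] := contact_indices km.
set E := (3 * k.+1 - 1)%N in root qE; set j := (m - k)%N in jm ej qE eltq.
set e := (3 * j - 1)%N in ej qE eltq.
(* Clearing the denominator s0 turns the root of Q_(k+1) into the hypothesis of [node_condition], up
   to the factor (-s0)^E. *)
have scale (c : K) : A - c * s0 = - s0 * (- (A / s0) + c) by field.
have node := node_condition char_q w3 w1 k3 herm0 ej qE.
have nongap : nongaps P (j * (3 * m).+1 - e)%N.
  apply: (contact_nongap m0 tL genL char_q w3 w1 k3 herm0 s00 t00 nfix _ ej eltq xP yP).
  apply: node.
  by rewrite !scale !exprMn mulrCA [X in _ + X]mulrCA -mulrDr root mulr0.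
move=> gapsE; have := contact_in_Ggen jm; rewrite -/e -gapsE; exact.
Qed.
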